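(* Let $p$ be a prime, $k\ge2$ an integer, $q=p^k$, and let $r\ge2$ and $s\ge1$ be integers. Let $\epsilon\in(0,1)$. Then there exist more than $(1-\epsilon)\,q^r(\varphi(q-1))^r$ pairs $(\boldsymbol\alpha,\boldsymbol\beta)\in F_q^r\times\hat F_q^r$ such that for all integers $N_1,\dots,N_r\in[1,q]$ with $N_1\cdots N_r\le q$ and all integers $s_1,\dots,s_r\in[1,s]$ with $s_0:=s_1\cdots s_r\le s$, the bound $$D\big((\mathbf{x}_{\mathbf n})_{0\le n_w<N_w,\,1\le w\le r}\big)\le \epsilon^{-1}c_2\,(N_1\cdots N_r)^{-1/2}\,\ln^{s_0+2.5r}(2^{r+1}N_1\cdots N_r)\,\ln^{2.5r}\!\big(3\ln(6N_1\cdots N_r)\big)$$ holds, where the constant $c_2$ depends only on $s_1,\dots,s_r$.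
   Context: $F_q$ is the finite field with $q$ elements, $\varphi$ is Euler's function, $\hat F_q$ is the set of primitive elements of $F_q$, $Tr:F_q\to F_p$ is the trace, and elements of $F_p$ are identified with integers in $\{0,\dots,p-1\}$. For $w,i\in\{1,\dots,r\}$, $w\ne i$, put $d_{w,i}=w-1$ if $w<i$ and $d_{w,i}=w-2$ if $w>i$. For $\mathbf n=(n_1,\dots,n_r)$ with nonnegative integer entries and $i\in\{1,\dots,r\}$ let $\tilde n_i\in[0,s^{r-1})$ be the integer with $\tilde n_i\equiv\sum_{w\in[1,r],w\ne i} n_w s^{d_{w,i}}\pmod{s^{r-1}}$. For $\boldsymbol\alpha=(\alpha_1,\dots,\alpha_r)\in F_q^r$, $\boldsymbol\beta=(\beta_1,\dots,\beta_r)\in\hat F_q^r$ and $1\le j\le k$, let $y(\mathbf n,j)\in\{0,\dots,p-1\}$ be given by $y(\mathbf n,j)\equiv\sum_{i=1}^r Tr\big(\alpha_i\beta_i^{k(n_i+s\tilde n_i)+j-1}\big)\pmod p$, and set $x_{\mathbf n}=\sum_{j=1}^k y(\mathbf n,j)/p^j\in[0,1)$. Given $s_1,\dots,s_r$, let $\mathbf x_{\mathbf n}=(x_{\mathbf n+\mathbf i})_{0\le i_w<s_w,\,1\le w\le r}\in[0,1)^{s_0}$, where $\mathbf i=(i_1,\dots,i_r)$ (coordinates listed in a fixed order). The discrepancy of a finite family of $M$ points $\mathbf z$ in $[0,1)^{d}$ is $\sup_{0<\gamma_1,\dots,\gamma_d\le1}\big|\#\{\mathbf z\in[0,\gamma_1)\times\cdots\times[0,\gamma_d)\}/M-\gamma_1\cdots\gamma_d\big|$;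 here the family is $\{\mathbf x_{\mathbf n}:0\le n_w<N_w,\ 1\le w\le r\}$ with $M=N_1\cdots N_r$ (counted with multiplicity).
   Formalization: The constant c_2 may depend on s as well as on s_1,…,s_r (still not on p, k, q, ε, N); independence of s is false, e.g. r=2, p=2, s=q−1, s_1=s_2=2, N_1=q, N_2=1, where D≥1/32 for every pair while the bound tends to 0 as k grows. *)

(* Defs.v *)
From HB Require Import structures.
From mathcomp Require Import all_boot all_order all_algebra.
From mathcomp Require Import falgebra fieldext galois finfield.
From mathcomp Require Import boolp classical_sets reals exp.

Set Implicit Arguments.
Unset Strict Implicit.
Unset Printing Implicit Defensive.

Import Order.TTheory GRing.Theory Num.Theory.

Local Open Scope ring_scope.

Section AbsoluteTrace.

Variables (p : nat) (F : finFieldType) (chF : p \in [pchar F]).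

(* [pPrimeCharType chF] is F viewed as a splitting field over 'F_p. The library
   trace takes values in F, inside the prime subfield; [absTr] is the element of
   'F_p with that value ([absTrE]), so the default value 0 is never used. *)
Definition absTr (x : F) : 'F_p :=
  odflt 0 [pick a : 'F_p |
    a%:A == galTrace 1%AS {:pPrimeCharType chF} (x : pPrimeCharType chF)].

Lemma absTrE (x : F) :
  (absTr x)%:A = galTrace 1%AS {:pPrimeCharType chF} (x : pPrimeCharType chF).
Proof.
rewrite /absTr; case: pickP => [a /eqP //|none].
have gal1 : galois (1%AS : {subfield pPrimeCharType chF}) {:pPrimeCharType chF}.
  exact: finField_galois (sub1v _).
have /vlineP[a Ea] := mem_galTrace gal1 (memvf (x : pPrimeCharType chF)).
by have := none a; rewrite Ea eqxx.
Qed.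

End AbsoluteTrace.

Section Net.

Variables (R : realType) (p k r s : nat).
Variables (F : finFieldType) (chF : p \in [pchar F]).
Variables (alpha beta : {ffun 'I_r -> F}).

(* Indices in {1,..,r} and {1,..,k} become 0-based throughout. *)

(* d_(w,i), meaningful for w != i. *)
Definition dexp (w i : 'I_r) : nat := if (w < i)%N then (w : nat) else (w : nat).-1.

Definition ntilde (n : 'I_r -> nat) (i : 'I_r) : nat :=
  ((\sum_(w < r | w != i) n w * s ^ dexp w i) %% s ^ r.-1)%N.

(* The digit of index j.+1, hence exponent k * (...) + j. The element
   [absTr _ : 'F_p] is read as its representative in {0,..,p-1}. *)
Definition ydigit (n : 'I_r -> nat) (j : nat) : nat :=
  ((\sum_(i < r)
     (absTr chF
        (alpha i * beta i ^+ (k * (n i + s * ntilde n i) + j)%N)%R : nat))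
   %% p)%N.

Definition xpoint (n : 'I_r -> nat) : R :=
  \sum_(j < k) (ydigit n j)%:R / p%:R ^+ j.+1.

(* Vectors in [0,1)^(s_1 * .. * s_r) have their coordinates indexed by the box
   of shifts itself, as the discrepancy does not depend on their order. *)
Definition xvec (S : 'I_r -> nat) (n : 'I_r -> nat)
    (i : {dffun forall w : 'I_r, 'I_(S w)}) : R :=
  xpoint (fun w => (n w + i w)%N).

End Net.

(* Discrepancy of a family of #|T| points in [0,1)^I. *)
Definition discrepancy (R : realType) (T I : finType) (z : T -> I -> R) : R :=
  sup [set D : R | exists2 gam : I -> R,
         (forall i, 0 < gam i <= 1) &
         D = `| #|[set t : T | [forall i, 0 <= z t i < gam i]]|%:R / #|T|%:R
                - \prod_i gam i |]%classic.

(* Main.v *)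
(** For fixed nonzero frequency H, averaging over alpha turns the square of the character
    sum over a box of n into q^r times the number of pairs (n, n') for which, in every
    coordinate w, beta_w^(k n_w) T(beta_w) = beta_w^(k n'_w) T'(beta_w); here T and T' are
    nonzero polynomials over F_p of degree less than k s^r, since the exponents
    attached to the shifts are distinct.  As beta_w is primitive, averaging over beta
    bounds this by the number of n up to factors m sqrt m per coordinate of length 2^m,
    where n / totient n = O(sqrt (log n)) is used.
    The Rademacher-Menshov dyadic decomposition makes the bound uniform over all
    N_w < 2^m_w at the cost of a factor m_w^2, and a single Markov inequality for the sum
    over all scales m costs the remaining summable weights.
    The discrepancy is reduced to these sums by Fourier analysis on the digit group
    F_p^k: an interval is a sum of digit cylinders times intervals of Z/p, and an interval
    of Z/p smoothed at scale 2^i0 telescopes over dyadic scales into functions which are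
    convolutions of two intervals of equal length, whose Fourier coefficients have bounded
    sum by Parseval.  Thus the total weight of the frequencies is O(log M) per
    dimension, with no dependence on p. *)

Require Import Defs.
From HB Require Import structures.
From mathcomp Require Import all_boot all_order all_algebra.
From mathcomp Require Import falgebra fieldext galois finfield.
From mathcomp Require Import boolp classical_sets reals exp.
From mathcomp Require Import complex zify ring lra.

Set Implicit Arguments.
Unset Strict Implicit.
Unset Printing Implicit Defensive.

Import Order.TTheory GRing.Theory Num.Theory.
Local Open Scope ring_scope.

(** * Arithmetic of natural numbers *)

(** The bound has to be in terms of the N_w, while counting collisions loses k and (q - 1) / phi(q -
    1), which depend on q. A scale m with 2^m below a small power of q has room to absorb both; at
    larger scales log q is comparable with m. Per coordinate the mean square of the character sums
    is then of order 2^m m^(3/2), the maximal inequality multiplies it by m^2, and a further m^(3/2)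
    makes the scales summable: m^5 in all, whose square root gives the exponent 5/2 per coordinate.
    The exponent s_0 of the logarithm is the total weight of the frequencies. That weight must be
    fixed before the box of the discrepancy, since alpha and beta are chosen before it; hence the
    Fourier coefficients of an interval are always dominated by a function of the frequency that
    ignores the endpoints. The digits are resolved up to 2^-mu, where 2^mu <= N_1 ... N_r < 2^(r +
    mu), so that truncation costs only O(1 / (N_1 ... N_r)). *)

(** For x >= 2 c + 1 one has (x / (x - 1))^2 <= (2 c + 1) / (2 c - 1), and these factors telescope
    since c grows by 1 along increasing odd numbers. Of the primes only order and parity enter,
    whence a square root of the logarithm in the totient bound. *)
Lemma odd_list_prod (l : seq nat) (c : nat) :
  (0 < c)%N -> sorted ltn l -> all (fun x => odd x && (2 * c + 1 <= x)%N) l ->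
  (\prod_(x <- l) x ^ 2 * (2 * c - 1) <=
   (2 * (c + size l) - 1) * \prod_(x <- l) x.-1 ^ 2)%N.
Proof.
elim: l c => [|x l IH] c c0 /=; first by rewrite !big_nil mul1n muln1 addn0.
move=> pxl /andP[/andP[ox cx] al]; rewrite !big_cons.
have {}IH := IH c.+1 isT (path_sorted pxl).
have /IH {}IH : all (fun y => odd y && (2 * c.+1 + 1 <= y)%N) l.
  apply/allP => y yl; have /allP /(_ y yl) /= /andP[oy _] := al.
  rewrite oy /=; have /allP /(_ y yl) /= := order_path_min ltn_trans pxl.
  move: ox oy cx; lia.
have e : (2 * c.+1 - 1 = 2 * c + 1)%N by lia.
rewrite e in IH.
have hx : (x ^ 2 * (2 * c - 1) <= (2 * c + 1) * x.-1 ^ 2)%N.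
  have [y ->] : exists y, x = (2 * c + 1 + y)%N by exists (x - (2 * c + 1))%N; lia.
  have [d ->] : exists d, c = d.+1 by exists c.-1; lia.
  nia.
set P := (\prod_(_ <- _) _)%N in IH *; set Q := (\prod_(_ <- _) _)%N in IH *.
have -> : (x ^ 2 * P * (2 * c - 1) = P * (x ^ 2 * (2 * c - 1)))%N by lia.
apply: (leq_trans (leq_mul (leqnn P) hx)).
have -> : (P * ((2 * c + 1) * x.-1 ^ 2) = (P * (2 * c + 1)) * x.-1 ^ 2)%N by lia.
apply: (leq_trans (leq_mul IH (leqnn _))).
by rewrite addnS addSn [(x.-1 ^ 2 * Q)%N]mulnC mulnA.
Qed.

(** The least prime may be 2 and costs a factor at most (2 / 1)^2 = 4; all others are odd. *)
Lemma prime_list_prod (l : seq nat) :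
  sorted ltn l -> all prime l ->
  (\prod_(x <- l) x ^ 2 <= 4 * (2 * size l + 1) * \prod_(x <- l) x.-1 ^ 2)%N.
Proof.
have odd_case l' : sorted ltn l' -> all prime l' -> all (fun x => 2 < x)%N l' ->
  (\prod_(x <- l') x ^ 2 <= (2 * size l' + 1) * \prod_(x <- l') x.-1 ^ 2)%N.
  move=> sl pl gl.
  rewrite (_ : 2 * size l' + 1 = 2 * (1 + size l') - 1)%N; last lia.
  rewrite -[X in (X <= _)%N]muln1; apply: (@odd_list_prod l' 1 isT sl).
  apply/allP => x xl; have /allP /(_ x xl) px := pl.
  have /allP /(_ x xl) gx := gl.
  have [e|ox] := even_prime px; first by rewrite e in gx.
  by rewrite ox.
case: l => [|x l] sl; first by rewrite !big_nil.
move=> pl; move: (pl) => /= /andP[px pl'].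
have gl : all (fun y => x < y)%N l by exact: (order_path_min ltn_trans sl).
have x2 := prime_gt1 px.
have gl' : all (fun y => 2 < y)%N l by apply/sub_all: gl => y; lia.
have := odd_case _ (path_sorted sl) pl' gl'.
rewrite !big_cons /=; set P := (\prod_(_ <- _) _)%N; set Q := (\prod_(_ <- _) _)%N.
move=> PQ; have hx : (x ^ 2 <= 4 * x.-1 ^ 2)%N.
  have [y ->] : exists y, x = (2 + y)%N by exists (x - 2)%N; lia.
  nia.
apply: (leq_trans (leq_mul hx PQ)).
have : ((2 * size l + 1) <= (2 * (size l).+1 + 1))%N by lia.
set u := (2 * size l + 1)%N; set v := (2 * (size l).+1 + 1)%N => uv.
have -> : (4 * x.-1 ^ 2 * (u * Q) = u * (4 * (x.-1 ^ 2 * Q)))%N by lia.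
have -> : (4 * v * (x.-1 ^ 2 * Q) = v * (4 * (x.-1 ^ 2 * Q)))%N by lia.
exact: leq_mul.
Qed.

(** The quotient n / totient n is the product of p / (p - 1) over the primes dividing n, and there
    are at most log2 n of them because their product is at most n. *)
Lemma totient_lower_bound (n : nat) : (0 < n)%N ->
  (n ^ 2 <= 4 * (2 * trunc_log 2 n + 1) * totient n ^ 2)%N.
Proof.
move=> n0.
have e1 : n = (\prod_(p <- primes n) p ^ logn p n)%N.
  by rewrite {1}(prod_prime_decomp n0) prime_decompE big_map /=.
have e2 := totientE n0.
have e : (n * \prod_(p <- primes n) p.-1 = totient n * \prod_(p <- primes n) p)%N.
  rewrite e2 {1}e1 -!big_split /= ; apply: eq_big_seq => p pn.
  have : (0 < logn p n)%N by rewrite logn_gt0.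
  by case: (logn p n) => // m _; rewrite /= expnS mulnC mulnA mulnAC.
have all_p : all prime (primes n) by apply/allP => p; rewrite mem_primes => /andP[].
have h := prime_list_prod (sorted_primes n) all_p.
have prod_ge (l : seq nat) : all prime l -> (2 ^ size l <= \prod_(x <- l) x)%N.
  elim: l => [|x l IH] /=; first by rewrite big_nil.
  by move=> /andP[px /IH hl]; rewrite big_cons expnS leq_mul // prime_gt1.
have sz : (size (primes n) <= trunc_log 2 n)%N.
  apply: trunc_log_max => //; apply: (leq_trans (prod_ge _ all_p)).
  rewrite {2}e1 big_seq_cond [X in (_ <= X)%N]big_seq_cond.
  apply: leq_prod => p /andP[pn _].
  by rewrite -{1}[p]expn1 leq_exp2l ?logn_gt0 // prime_gt1 // (allP all_p).
set A := (\prod_(p <- primes n) p)%N in e *; set B := (\prod_(p <- primes n) p.-1)%N in e *.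
have eA : (\prod_(x <- primes n) x ^ 2 = A ^ 2)%N.
  by rewrite -mulnn /A -big_split /=; apply: eq_bigr => x _; rewrite mulnn.
have eB : (\prod_(x <- primes n) x.-1 ^ 2 = B ^ 2)%N.
  by rewrite -mulnn /B -big_split /=; apply: eq_bigr => x _; rewrite mulnn.
rewrite eA eB in h.
have A0 : (0 < A)%N by apply: leq_trans (prod_ge _ all_p); rewrite expn_gt0.
have B0 : (0 < B)%N.
  by rewrite /B big_seq_cond; apply: prodn_cond_gt0 => p /andP[/(allP all_p)/prime_gt1]; lia.
rewrite -(leq_pmul2r (m := B ^ 2)) ?expn_gt0 ?B0 // -expnMn e expnMn.
rewrite [X in (_ <= X)%N]mulnAC [X in (_ <= X)%N]mulnC leq_mul //.
apply: (leq_trans h); rewrite leq_mul // leq_mul //; lia.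
Qed.

(** Turns the losses k and q / phi into powers of the scale m. With l = log2 q and k <= l: if l <= 4
    m, then k costs m and the totient costs sqrt m, and 96^2 = 1024 * 9 arises from 2 l + 1 <= 9 m;
    if l > 4 m, then 4^m <= 2^l leaves a factor 2^l to absorb k^2 (2 l + 1). *)
Lemma scale_totient_bound (p k m : nat) :
  (1 < p)%N -> (0 < k)%N -> (1 < p ^ k)%N -> (2 ^ m <= 2 * p ^ k)%N -> (0 < m)%N ->
  ((k * 2 ^ m) ^ 2 <= 96 ^ 2 * m ^ 3 * totient (p ^ k - 1) ^ 2)%N.
Proof.
move=> p1 k0 q1 mq m0; set q := (p ^ k)%N in q1 mq *.
set phi := totient _; set l := trunc_log 2 q.
have q0 : (0 < q)%N by lia.
have kl : (k <= l)%N.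
  by apply: trunc_log_max => //; rewrite leq_exp2r.
have lq : (2 ^ l <= q)%N by exact: trunc_logP.
have Q : (q <= 2 * (q - 1))%N by lia.
have := @totient_lower_bound (q - 1); rewrite -/phi => /(_ ltac:(lia)) tb.
have {}tb : ((q - 1) ^ 2 <= 4 * (2 * l + 1) * phi ^ 2)%N.
  apply: (leq_trans tb); rewrite leq_mul2r leq_mul2l /=; apply/orP; right.
  by rewrite leq_add2r leq_mul2l /= leq_trunc_log ?leq_subr.
case: (leqP l (4 * m)) => lm.
  have h1 : ((k * 2 ^ m) ^ 2 <= (4 * m * (4 * (q - 1))) ^ 2)%N.
    rewrite leq_exp2r // leq_mul //; lia.
  apply: (leq_trans h1).
  have -> : ((4 * m * (4 * (q - 1))) ^ 2 = 256 * m ^ 2 * (q - 1) ^ 2)%N.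
    by move: (q - 1)%N => w; ring.
  apply: (leq_trans (leq_mul (leqnn _) tb)).
  have -> : (256 * m ^ 2 * (4 * (2 * l + 1) * phi ^ 2) = 1024 * m ^ 2 * (2 * l + 1) * phi ^ 2)%N by ring.
  rewrite leq_mul2r; apply/orP; right.
  rewrite (_ : 96 ^ 2 * m ^ 3 = 1024 * m ^ 2 * (9 * m))%N; last by ring.
  rewrite leq_mul2l; apply/orP; right. lia.
have cube j : (j ^ 3 <= 8 * 2 ^ j)%N.
  elim: j => // j IH; rewrite [(2 ^ j.+1)%N]expnS.
  case: (ltnP j 4) => [|j4]; first by case: j {IH} => [|[|[|[|]]]].
  suff h : (j.+1 ^ 3 <= 2 * j ^ 3)%N.
    by apply: (leq_trans h); rewrite [X in (_ <= X)%N]mulnCA leq_mul2l.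
  have [d ->] : exists d, j = (4 + d)%N by exists (j - 4)%N; lia.
  by rewrite !expnS !expn0 !muln1; nia.
have m2 : (2 ^ m * 2 ^ m <= 2 ^ l)%N by rewrite -expnD leq_exp2l //; lia.
have h1 : (k ^ 2 * (2 * l + 1) <= 24 * 2 ^ l)%N.
  have : (k ^ 2 <= l ^ 2)%N by rewrite leq_exp2r.
  have := cube l; have : (0 < l)%N by lia.
  move: (2 ^ l)%N => z l0 hz hk.
  apply: (leq_trans (leq_mul hk (leqnn _))); nia.
have h2 : (k ^ 2 * (2 * l + 1) * (2 ^ m * 2 ^ m) <= 96 * (q - 1) ^ 2)%N.
  apply: (leq_trans (leq_mul h1 m2)).
  have : (2 ^ l * 2 ^ l <= q * q)%N by exact: leq_mul.
  have : (q * q <= (2 * (q - 1)) * (2 * (q - 1)))%N by exact: leq_mul.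
  move: (2 ^ l)%N (q - 1)%N => z w; nia.
have h3 : (k ^ 2 * (2 ^ m * 2 ^ m) * (2 * l + 1) <= 384 * phi ^ 2 * (2 * l + 1))%N.
  rewrite mulnAC; apply: (leq_trans h2).
  apply: (leq_trans (leq_mul (leqnn 96) tb)); lia.
rewrite leq_pmul2r in h3; last lia.
rewrite expnMn -[((2 ^ m) ^ 2)%N]mulnn (leq_trans h3) // leq_mul2r; apply/orP; right.
have : (0 < m ^ 3)%N by rewrite expn_gt0 m0.
lia.
Qed.

Lemma base_digits_bound (s m : nat) (f : 'I_m -> nat) :
  (forall d, (f d < s)%N) -> (\sum_(d < m) f d * s ^ d < s ^ m)%N.
Proof.
elim: m f => [|m IH] f hf; first by rewrite big_ord0.
rewrite big_ord_recr /= expnSr.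
have := IH (fun d => f (widen_ord (leqnSn m) d)) (fun d => hf _); have := hf ord_max.
move: (\sum_(_ < _) _)%N (s ^ m)%N => a b; nia.
Qed.

Lemma base_digits_inj (s m : nat) (f g : 'I_m -> nat) :
  (forall d, (f d < s)%N) -> (forall d, (g d < s)%N) ->
  (\sum_(d < m) f d * s ^ d = \sum_(d < m) g d * s ^ d)%N -> f =1 g.
Proof.
elim: m f g => [|m IH] f g hf hg; first by move=> _ [].
rewrite !big_ord_recr /= => e.
have bf := base_digits_bound (fun d => hf (widen_ord (leqnSn m) d)).
have bg := base_digits_bound (fun d => hg (widen_ord (leqnSn m) d)).
have em : f ord_max = g ord_max.
  have := congr1 (fun x => x %/ s ^ m)%N e.
  have s0 : (0 < s ^ m)%N by apply: leq_ltn_trans bf.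
  by rewrite ![(\sum_(_ < _) _ + _)%N]addnC !divnMDl // !divn_small // !addn0.
rewrite em in e; move/addIn: e => e d.
have := IH _ _ (fun d => hf _) (fun d => hg _) e.
case: (unliftP ord_max d) => [d' ->|-> //] h.
have -> : lift ord_max d' = widen_ord (leqnSn m) d' by apply: val_inj; exact: lift_max.
exact: h.
Qed.

(** Measured from the least element x0, each k (x - x0) is a multiple of Q not above k l, and its
    quotient by Q determines x. Counting multiples in this way avoids gcd (k, Q). *)
Lemma card_congr_multiples (B a l k Q : nat) (A : {set 'I_B}) :
  (0 < k)%N -> (0 < Q)%N ->
  (forall x, x \in A -> (a <= x < a + l)%N) ->
  (forall x y, x \in A -> y \in A -> k * x = k * y %[mod Q]) ->
  (#|A| <= (k * l) %/ Q + 1)%N.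
Proof.
move=> k0 Q0 hA hmod; case: (set_0Vmem A) => [->|[y yA]]; first by rewrite cards0.
have [x0 x0A x0min] := @arg_minnP _ y (mem A) (fun x => x : nat) yA.
have hQ x : x \in A -> exists2 u, (k * (x - x0) = Q * u)%N & (u <= (k * l) %/ Q)%N.
  move=> xA; have := hmod _ _ xA x0A; move/eqP; rewrite eqn_mod_dvd; last first.
    by rewrite leq_mul2l x0min ?orbT.
  rewrite -mulnBr => /dvdnP[u hu]; exists u; first by rewrite hu mulnC.
  rewrite leq_divRL // -hu leq_mul2l; have := hA _ xA; have := hA _ x0A; lia.
pose f (x : 'I_B) : 'I_((k * l) %/ Q).+1 := inord ((k * (x - x0)) %/ Q)%N.
have finj : {in A &, injective f}.
  move=> x z xA zA /(congr1 val); rewrite /f /=.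
  have [u eu lu] := hQ _ xA; have [v ev lv] := hQ _ zA.
  rewrite eu ev !mulKn // !inordK ?ltnS // => uv; apply/val_inj => /=.
  have : (k * (x - x0) = k * (z - x0))%N by rewrite eu ev uv.
  move/eqP; rewrite eqn_pmul2l // => /eqP; have := x0min _ xA; have := x0min _ zA; lia.
by rewrite -(card_in_imset finj) addn1 -[X in (_ <= X)%N]card_ord max_card.
Qed.

(** Each binary digit 1 of N, at position j, contributes the block of length 2^j that ends at (N /
    2^j) 2^j, and these blocks tile [0, N). Halving N and x gives the induction. *)
Lemma dyadic_split (m x N : nat) : (N < 2 ^ m)%N ->
  ((x < N)%N : nat) = (\sum_(j < m) (odd (N %/ 2 ^ j) && ((x %/ 2 ^ j).+1 == N %/ 2 ^ j)))%N.
Proof.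
elim: m x N => [|m IH] x N; first by rewrite big_ord0 expn0; case: N.
move=> hN; rewrite big_ord_recl expn0 !divn1.
have hN2 : (N %/ 2 < 2 ^ m)%N by rewrite ltn_divLR // -expnSr.
under eq_bigr => j _ do rewrite lift0 expnS !divnMA.
rewrite -(IH (x %/ 2)%N) //; move: hN => _; lia.
Qed.

(** * Fourier analysis on Z/p *)

Section ComplexNorm.

Variable R : realType.
Implicit Types z : R[i].

Import Normc.

Lemma norm_normc z : `|z| = (normc z)%:C%C.
Proof. by []. Qed.

Lemma normc_ge0 z : 0 <= normc z.
Proof. by case: z => a b; rewrite sqrtr_ge0. Qed.

Lemma normc_sum (I : Type) (s : seq I) (P : pred I) (F : I -> R[i]) :
  normc (\sum_(i <- s | P i) F i) <= \sum_(i <- s | P i) normc (F i).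
Proof.
by rewrite -lecR -norm_normc rmorph_sum /= (le_trans (ler_norm_sum _ _ _)) // lexx.
Qed.

Lemma normc_prod (I : Type) (s : seq I) (P : pred I) (F : I -> R[i]) :
  normc (\prod_(i <- s | P i) F i) = \prod_(i <- s | P i) normc (F i).
Proof. exact: (big_morph _ (@normcM R) (@normc1 R)). Qed.

Lemma normcB z1 z2 : normc (z1 - z2) <= normc z1 + normc z2.
Proof. by rewrite -lecR rmorphD /= -!norm_normc ler_normB. Qed.

Lemma normcD z1 z2 : normc (z1 + z2) <= normc z1 + normc z2.
Proof. by rewrite -lecR rmorphD /= -!norm_normc ler_normD. Qed.

Lemma normc_real (x : R) : normc (x%:C%C) = `|x|.
Proof. by rewrite /= expr0n addr0 sqrtr_sqr. Qed.

Lemma normc_nat n : normc (n%:R : R[i]) = n%:R.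
Proof. by rewrite -[n%:R](rmorph_nat (real_complex R)) normc_real normr_nat. Qed.

Lemma normcX z n : normc (z ^+ n) = normc z ^+ n.
Proof. by elim: n => [|n IH]; rewrite ?expr0 ?normc1 // !exprS normcM IH. Qed.

Lemma sqr_normcE z : (normc z ^+ 2)%:C%C = z * z^*%C.
Proof. by rewrite rmorphXn /= -norm_normc sqr_normc. Qed.

Lemma conjcM z w : (z * w)^*%C = z^*%C * w^*%C.
Proof. exact: (rmorphM (@conjc R)). Qed.

Lemma conjc_sum (I : Type) (s : seq I) (P : pred I) (F : I -> R[i]) :
  (\sum_(i <- s | P i) F i)^*%C = \sum_(i <- s | P i) (F i)^*%C.
Proof. exact: (rmorph_sum (@conjc R)). Qed.

Lemma normc_unity_root z n : (0 < n)%N -> z ^+ n = 1 -> normc z = 1.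
Proof.
move=> n0 /(congr1 (@normc R)); rewrite normcX normc1 => /eqP.
by rewrite pexpr_eq1 ?normc_ge0 // => /eqP.
Qed.

Lemma conjc_unit z : normc z = 1 -> z^*%C = z^-1.
Proof.
move=> z1; have zz : z * z^*%C = 1 by rewrite -sqr_normcE z1 expr1n.
have z0 : z != 0 by apply/eqP => z0; move: zz; rewrite z0 mul0r => /eqP; rewrite eq_sym oner_eq0.
by apply: (mulfI z0); rewrite zz divff.
Qed.

(** A root of 1 + z + ... + z^(p-1), taken from algebraic closedness, so that no analytic
    exponential is involved. *)
Lemma unity_root_exists (p : nat) : (1 < p)%N ->
  exists2 z : R[i], z ^+ p = 1 & z != 1.
Proof.
move=> p1; pose P : {poly R[i]} := \poly_(i < p) 1.
have sP : size P != 1.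
  by rewrite size_poly_eq ?oner_neq0 //; case: p p1 {P} => [|[|]].
have [z zP] := closed_rootP _ sP.
have hz : \sum_(i < p) z ^+ i = 0.
  have /eqP := zP; rewrite horner_poly => {2}<-.
  by apply: eq_bigr => i _; rewrite mul1r.
exists z; first by apply/eqP; rewrite -subr_eq0 subrX1 hz mulr0.
apply/eqP => z1; move: hz; rewrite z1; under eq_bigr do rewrite expr1n.
by rewrite sumr_const card_ord => /eqP; rewrite pnatr_eq0 => /eqP p0; rewrite p0 in p1.
Qed.

End ComplexNorm.

Lemma character_sum0 (K : idomainType) (G : finZmodType) (f : G -> K) (a : G) :
  {morph f : x y / x + y >-> x * y} -> f a != 1 -> \sum_x f x = 0.
Proof.
move=> fM fa; have : \sum_x f x = f a * \sum_x f x.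
  rewrite mulr_sumr; under [RHS]eq_bigr => x _ do rewrite -fM.
  by rewrite [LHS](reindex_inj (addrI a)).
move/eqP; rewrite -subr_eq0 -{1}[\sum_x _]mul1r -mulrBl mulf_eq0 subr_eq0 eq_sym.
by rewrite (negPf fa) /= => /eqP.
Qed.

Section PrimeFieldCharacter.

Variables (R : realType) (p : nat) (zeta : R[i]).
Hypotheses (p_pr : prime p) (zetaX : zeta ^+ p = 1) (zeta1 : zeta != 1).

Import Normc.
Local Notation Fp := 'F_p.

Definition chi (a : Fp) : R[i] := zeta ^+ (a : nat).

Lemma chi_nat n : chi n%:R = zeta ^+ n.
Proof. by rewrite /chi val_Fp_nat // expr_mod. Qed.

Lemma chi1 : chi 1 = zeta. Proof. exact: (chi_nat 1). Qed.

Lemma chi0 : chi 0 = 1. Proof. exact: (chi_nat 0). Qed.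

Lemma chiD : {morph chi : a b / a + b >-> a * b}.
Proof.
move=> a b; rewrite -[a]natr_Zp -[b]natr_Zp -natrD !chi_nat exprD //.
Qed.

Lemma chi_sum (I : Type) (s : seq I) (P : pred I) (F : I -> Fp) :
  chi (\sum_(i <- s | P i) F i) = \prod_(i <- s | P i) chi (F i).
Proof. exact: (big_morph _ chiD chi0). Qed.

Lemma chiMn a n : chi (a *+ n) = chi a ^+ n.
Proof. by elim: n => [|n IH]; rewrite ?chi0 // mulrS chiD IH exprS. Qed.

Lemma normc_zeta : normc zeta = 1.
Proof. exact: normc_unity_root (prime_gt0 p_pr) zetaX. Qed.

Lemma normc_chi a : normc (chi a) = 1.
Proof. by rewrite /chi normcX normc_zeta expr1n. Qed.

Lemma chi_neq0 a : chi a != 0.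
Proof. by apply/eqP => h; have := normc_chi a; rewrite h normc0 => /eqP; rewrite eq_sym oner_eq0. Qed.

Lemma chiN a : chi (- a) = (chi a)^-1.
Proof. by apply: (mulfI (chi_neq0 a)); rewrite -chiD subrr chi0 divff ?chi_neq0. Qed.

Lemma conjc_chi a : (chi a)^*%C = chi (- a).
Proof. by rewrite conjc_unit ?normc_chi // chiN. Qed.

Lemma chi_neq1 a : a != 0 -> chi a != 1.
Proof.
move=> a0; apply: contra zeta1 => /eqP ha.
by rewrite -chi1 -(mulfV a0) -[a^-1]natr_Zp mulr_natr chiMn ha expr1n.
Qed.

Lemma chi_orthogonality a : \sum_(h : Fp) chi (h * a) = if a == 0 then p%:R else 0.
Proof.
case: eqVneq => [->|a0].
  under eq_bigr do rewrite mulr0 chi0.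
  by rewrite sumr_const card_Fp.
apply: (@character_sum0 _ _ (fun h : Fp => chi (h * a)) 1) => [x y|].
  by rewrite mulrDl chiD.
by rewrite mul1r chi_neq1.
Qed.

Lemma parseval (c : Fp -> R) :
  \sum_(h : Fp) normc (\sum_v (c v)%:C%C * chi (- h * v)) ^+ 2 = p%:R * \sum_v c v ^+ 2.
Proof.
have E h v u : (c v)%:C%C * chi (- h * v) * ((c u)%:C%C * chi (- h * u))^*%C
    = (c v * c u)%:C%C * chi (h * (u - v)).
  rewrite conjcM conjc_real conjc_chi mulrACA -chiD rmorphM.
  by congr (_ * chi _); ring.
apply: (@complexI R); rewrite rmorph_sum rmorphM /= rmorph_sum rmorph_nat.
under eq_bigr => h _.
  rewrite sqr_normcE conjc_sum mulr_suml.
  under eq_bigr => v _.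
    by rewrite mulr_sumr; under eq_bigr => u _ do rewrite E; over.
  over.
rewrite exchange_big mulr_sumr; apply: eq_bigr => v _.
rewrite exchange_big (bigD1 v) //= [X in _ + X]big1 => [|u uv].
  by rewrite -mulr_sumr chi_orthogonality subrr eqxx addr0 mulrC -expr2.
by rewrite -mulr_sumr chi_orthogonality subr_eq0 (negPf uv) mulr0.
Qed.

Lemma sum_Fp (V : nmodType) (n : nat) (F : Fp -> V) : (n <= p)%N ->
  \sum_(v < n) F v%:R = \sum_(v : Fp | (v < n)%N) F v.
Proof.
move=> np; rewrite (big_ord_widen_cond (Zp_trunc (pdiv p)).+2 xpredT (fun v => F v%:R)) /=.
  by apply: eq_bigr => v _; rewrite natr_Zp.
by rewrite Fp_cast.
Qed.

Definition dirichlet (n : nat) (h : Fp) : R[i] := \sum_(v < n) chi (- h) ^+ v.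

Lemma dirichlet_mul n h : (1 - chi (- h)) * dirichlet n h = 1 - chi (- h) ^+ n.
Proof. by rewrite -opprB mulNr -subrX1 opprB. Qed.

Lemma dirichlet_energy n : (n <= p)%N ->
  \sum_(h : Fp) normc (dirichlet n h) ^+ 2 = (p * n)%:R.
Proof.
move=> np; have := parseval (fun v => (v < n)%N%:R); rewrite natrM.
have -> : \sum_(v : Fp) (v < n)%N%:R ^+ 2 = n%:R :> R.
  transitivity (\sum_(v : Fp | (v < n)%N) (1 : R)).
    rewrite [RHS]big_mkcond /=; apply: eq_bigr => v _.
    by case: (v < n)%N; rewrite ?expr1n ?expr0n.
  by rewrite -(sum_Fp (fun _ => 1)) // sumr_const card_ord.
move=> <-; apply: eq_bigr => h _; congr (normc _ ^+ 2).
rewrite /dirichlet; transitivity (\sum_(v < n) chi (- h * v%:R)).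
  by apply: eq_bigr => v _; rewrite mulr_natr chiMn.
rewrite (sum_Fp (fun v => chi (- h * v))) // big_mkcond /=; apply: eq_bigr => v _.
by case: ifP => _; rewrite ?rmorph1 ?rmorph0 ?mul1r ?mul0r.
Qed.

Lemma gap_neq0 h : h != 0 -> 1 - chi (- h) != 0.
Proof. by move=> h0; rewrite subr_eq0 eq_sym chi_neq1 // oppr_eq0. Qed.

Lemma gap_gt0 h : h != 0 -> 0 < normc (1 - chi (- h)).
Proof.
move=> h0; rewrite lt_def normc_ge0 andbT; apply/eqP => /eq0_normc/eqP.
by rewrite (negPf (gap_neq0 h0)).
Qed.

(* Parseval for the identity function on {0,..,p-1}, whose Fourier transform
   at h <> 0 is - p / (1 - chi (- h)). *)
Lemma sum_gap_inv : \sum_(h : Fp | h != 0) (normc (1 - chi (- h)) ^+ 2)^-1 <= p%:R ^+ 2.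
Proof.
have p0 : (0 : R) < p%:R by rewrite ltr0n prime_gt0.
have id_fourier n (z : R[i]) :
  (1 - z) * \sum_(v < n) v%:R * z ^+ v = \sum_(v < n) z ^+ v.+1 - n%:R * z ^+ n.
  elim: n => [|n IH]; first by rewrite !big_ord0 mulr0 mul0r subr0.
  by rewrite !big_ord_recr /= mulrDr IH exprS -natr1; ring.
pose c (v : Fp) : R := (v : nat)%:R.
have hc h : h != 0 ->
  normc (\sum_v (c v)%:C%C * chi (- h * v)) ^+ 2 = p%:R ^+ 2 * (normc (1 - chi (- h)) ^+ 2)^-1.
  move=> h0; apply: (canRL (mulfK _)); first by rewrite expf_neq0 // gt_eqF ?gap_gt0.
  rewrite -exprMn -normcM mulrC.
  have -> : \sum_v (c v)%:C%C * chi (- h * v) = \sum_(v < p) v%:R * chi (- h) ^+ v.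
    transitivity (\sum_(v < p) (c v%:R)%:C%C * chi (- h * v%:R)).
      rewrite (sum_Fp (fun v => (c v)%:C%C * chi (- h * v))) //; apply: eq_bigl => v.
      by have := ltn_ord v; rewrite [X in (_ < X)%N]Fp_cast // => ->.
    apply: eq_bigr => v _; rewrite mulr_natr chiMn /c val_Fp_nat // modn_small //.
    by rewrite rmorph_nat.
  rewrite id_fourier.
  have zp : chi (- h) ^+ p = 1 by rewrite -chiMn -mulr_natr pchar_Fp_0 // mulr0 chi0.
  have -> : \sum_(v < p) chi (- h) ^+ v.+1 = 0.
    under eq_bigr do rewrite exprS.
    rewrite -mulr_sumr; apply/eqP; rewrite mulf_eq0; apply/orP; right.
    by rewrite -(mulrI_eq0 _ (mulfI (gap_neq0 h0))) -[X in _ * X]/(dirichlet p h) dirichlet_mul zp subrr.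
  by rewrite zp mulr1 sub0r (@normcN R) normc_nat.
have := parseval c; rewrite (bigD1 0) //= => hp.
have : p%:R ^+ 2 * \sum_(h : Fp | h != 0) (normc (1 - chi (- h)) ^+ 2)^-1
       <= p%:R ^+ 2 * p%:R ^+ 2.
  rewrite mulr_sumr -(eq_bigr _ hc).
  apply: (@le_trans _ _ (p%:R * \sum_v c v ^+ 2)); first by rewrite -hp lerDr exprn_ge0 ?normc_ge0.
  rewrite -exprD exprS ler_pM2l //.
  apply: (@le_trans _ _ (\sum_(v : Fp) p%:R ^+ 2)).
    apply: ler_sum => v _; rewrite ler_pXn2r ?nnegrE // /c ler_nat ltnW //.
    by have := ltn_ord v; rewrite [X in (_ < X)%N -> _]Fp_cast.
  by rewrite sumr_const card_Fp // -[X in X <= _]mulr_natl -exprS.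
by rewrite ler_pM2l // exprn_gt0.
Qed.

(** The Fejer kernel of length 2^i. By [dirichlet_energy] its sum over h is p at every level with
    2^i <= p. *)
Definition level_energy (i : nat) (h : Fp) : R := normc (dirichlet (2 ^ i) h) ^+ 2 / (2 ^ i)%:R.

(* Follows from D_b D_l / l - D_b D_2l / (2l) = (1 - z^b) D_l^2 / (2l), where D_n is the
   sum of z^v over v < n: smoothing an interval at scale l instead of 2l changes it by
   a function whose Fourier coefficients are dominated independently of b. *)
Lemma dirichlet_telescope b l h : (0 < l)%N ->
  normc (dirichlet b h) * normc (dirichlet l h) / l%:R <=
  normc (dirichlet b h) * normc (dirichlet (2 * l) h) / (2 * l)%:R
  + normc (dirichlet l h) ^+ 2 / l%:R.
Proof.
move=> l0; set z := chi (- h).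
have hl (m : nat) : (1 + z ^+ m) * dirichlet m h = dirichlet (2 * m) h.
  rewrite mul2n -addnn /dirichlet big_split_ord /= mulrDl mul1r mulr_sumr.
  by congr (_ + _); apply: eq_bigr => v _; rewrite exprD.
have hb : (1 - z ^+ l) * dirichlet b h = (1 - z ^+ b) * dirichlet l h.
  by rewrite -!dirichlet_mul mulrAC.
have e : 2%:R * (dirichlet b h * dirichlet l h) =
         dirichlet b h * dirichlet (2 * l) h + (1 - z ^+ b) * (dirichlet l h * dirichlet l h).
  by rewrite -hl [X in _ + X]mulrA -hb; ring.
have l0' : (0 : R) < l%:R by rewrite ltr0n.
have nz : normc (1 - z ^+ b) <= 2.
  apply: (le_trans (normcB _ _)); rewrite normc1 normcX normc_chi expr1n; lra.
have : 2%:R * (normc (dirichlet b h) * normc (dirichlet l h)) <=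
   normc (dirichlet b h) * normc (dirichlet (2 * l) h) + 2 * normc (dirichlet l h) ^+ 2.
  rewrite -{1}normc_nat -!normcM e; apply: (le_trans (normcD _ _)).
  rewrite !normcM lerD2l expr2 ler_wpM2r // mulr_ge0 ?normc_ge0 //.
rewrite natrM.
set x := normc _ * _; set y := normc _ * _; set w := normc _ ^+ 2 => hxy.
rewrite [X in _ <= X](_ : _ = (y + 2 * w) / (2 * l%:R)); last by field; rewrite gt_eqF.
rewrite ler_pdivlMr ?mulr_gt0 //.
by rewrite (_ : x / l%:R * _ = 2 * x) //; field; rewrite gt_eqF.
Qed.

(** Telescoping from 2^i0 up to 2^a leaves one term at the top level, where both kernels are
    geometric sums bounded by 2 / |1 - z|. The length b has then disappeared from the right side. *)
Lemma dirichlet_level_bound b i0 a h : (i0 <= a)%N -> h != 0 ->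
  normc (dirichlet b h) * normc (dirichlet (2 ^ i0) h) / (2 ^ i0)%:R <=
  \sum_(i0 <= i < a) level_energy i h + 4 / (normc (1 - chi (- h)) ^+ 2 * (2 ^ a)%:R).
Proof.
move=> ia h0.
have bnd n : normc (dirichlet n h) <= 2 / normc (1 - chi (- h)).
  rewrite ler_pdivlMr ?gap_gt0 // mulrC -normcM dirichlet_mul.
  by apply: (le_trans (normcB _ _)); rewrite normc1 normcX normc_chi expr1n; lra.
have tele : normc (dirichlet b h) * normc (dirichlet (2 ^ i0) h) / (2 ^ i0)%:R <=
  \sum_(i0 <= i < a) level_energy i h
  + normc (dirichlet b h) * normc (dirichlet (2 ^ a) h) / (2 ^ a)%:R.
  elim: a ia => [|a IH]; first by rewrite leqn0 => /eqP ->; rewrite big_geq // add0r.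
  rewrite leq_eqVlt => /orP[/eqP <-|ia]; first by rewrite big_geq // add0r.
  apply: (le_trans (IH ia)); rewrite big_nat_recr //= -addrA lerD2l addrC expnS.
  by apply: dirichlet_telescope; rewrite expn_gt0.
apply: (le_trans tele); rewrite lerD2l invfM mulrA ler_pM2r ?invr_gt0 ?ltr0n ?expn_gt0 //.
rewrite (_ : 4 / _ = (2 / normc (1 - chi (- h))) * (2 / normc (1 - chi (- h)))).
  by apply: ler_pM; rewrite ?normc_ge0 // bnd.
by field; rewrite gt_eqF ?gap_gt0.
Qed.

(** A common majorant for the Fourier coefficients of all intervals smoothed at scale 2^i0, whatever
    their endpoints; the value 1 at h = 0 bounds the density. *)
Definition interval_weight (i0 a : nat) (h : Fp) : R :=
  if h == 0 then 1 else
  (\sum_(i0 <= i < a) level_energy i h + 4 / (normc (1 - chi (- h)) ^+ 2 * (2 ^ a)%:R)) / p%:R.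

Lemma level_energy_ge0 i h : 0 <= level_energy i h.
Proof. by rewrite divr_ge0 ?exprn_ge0 ?normc_ge0. Qed.

Lemma interval_weight_ge0 i0 a h : 0 <= interval_weight i0 a h.
Proof.
rewrite /interval_weight; case: ifP => // _; rewrite divr_ge0 // addr_ge0 //.
  by apply: sumr_ge0 => i _; exact: level_energy_ge0.
by rewrite divr_ge0 // mulr_ge0 ?exprn_ge0 ?normc_ge0.
Qed.

(** Each of the a - i0 levels has total energy p and so contributes 1. The constant 9 is 1 for h = 0
    plus 4 p / 2^a <= 8 for the top level, by [sum_gap_inv]. *)
Lemma sum_interval_weight i0 a : (2 ^ a <= p < 2 ^ a.+1)%N ->
  \sum_h interval_weight i0 a h <= (a - i0)%N%:R + 9.
Proof.
move=> /andP[ap pa].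
have p0 : (0 : R) < p%:R by rewrite ltr0n prime_gt0.
rewrite (bigD1 0) //= {1}/interval_weight eqxx.
rewrite (eq_bigr (fun h => (\sum_(i0 <= i < a) level_energy i h) / p%:R +
   (4 / (2 ^ a)%:R / p%:R) * (normc (1 - chi (- h)) ^+ 2)^-1)); last first.
  move=> h h0; rewrite /interval_weight (negPf h0) mulrDl; congr (_ + _).
  by rewrite invfM; ring.
rewrite big_split /= -mulr_suml -mulr_sumr.
have h1 : \sum_(h : Fp | h != 0) \sum_(i0 <= i < a) level_energy i h <= (a - i0)%N%:R * p%:R.
  apply: (@le_trans _ _ (\sum_h \sum_(i0 <= i < a) level_energy i h)).
    rewrite [X in _ <= X](bigD1 0) //= lerDr; apply: sumr_ge0 => i _; exact: level_energy_ge0.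
  rewrite exchange_big /= mulr_natl -sumr_const_nat; apply: ler_sum_nat => i /andP[_ ia].
  have ip : (2 ^ i <= p)%N by apply: leq_trans ap; rewrite leq_exp2l // ltnW.
  rewrite -mulr_suml dirichlet_energy // natrM mulfK // pnatr_eq0 -lt0n expn_gt0 //.
have h2 := sum_gap_inv.
have pa' : p%:R <= 2 * (2 ^ a)%:R :> R by rewrite -natrM ler_nat -expnS ltnW.
have a0 : (0 : R) < (2 ^ a)%:R by rewrite ltr0n expn_gt0.
have h3 : 4 / (2 ^ a)%:R / p%:R * (\sum_(h : Fp | h != 0) (normc (1 - chi (- h)) ^+ 2)^-1) <= 8.
  apply: (@le_trans _ _ (4 / (2 ^ a)%:R / p%:R * p%:R ^+ 2)).
    by rewrite ler_wpM2l // !divr_ge0 // ltW.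
  rewrite expr2 mulrA divfK ?gt_eqF // mulrAC ler_pdivrMr //; lra.
have h4 : (\sum_(h : Fp | h != 0) \sum_(i0 <= i < a) level_energy i h) / p%:R <= (a - i0)%N%:R.
  by rewrite ler_pdivrMr.
lra.
Qed.

(* The interval [t, t + b) of Z/p convolved with the uniform measure on [0, l). *)
Definition smooth_interval (t : Fp) (b l : nat) (v : Fp) : R :=
  (\sum_(u < l) \sum_(x < b) (v == t + u%:R + x%:R)%:R) / l%:R.

Definition smooth_coef (t : Fp) (b l : nat) (h : Fp) : R[i] :=
  chi (- h * t) * dirichlet b h * dirichlet l h / (p * l)%:R.

Lemma Fp_indicator (v y : Fp) :
  (v == y)%:R = \sum_h chi (h * v) * (chi (- h * y) / p%:R) :> R[i].
Proof.
under eq_bigr do rewrite mulrA.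
rewrite -mulr_suml; under eq_bigr => h _ do rewrite -chiD mulNr -mulrBr.
rewrite chi_orthogonality subr_eq0; case: eqVneq => _; rewrite ?mul0r // divff //.
by rewrite pnatr_eq0 -lt0n prime_gt0.
Qed.

Lemma smooth_interval_expand t b l v :
  (smooth_interval t b l v)%:C%C = \sum_h smooth_coef t b l h * chi (h * v).
Proof.
rewrite /smooth_interval rmorphM /= fmorphV rmorph_nat.
rewrite (_ : (\sum_(u < l) _)%:C%C = \sum_(u < l) \sum_(x < b) \sum_h
    chi (h * v) * (chi (- h * (t + u%:R + x%:R)) / p%:R)); last first.
  rewrite rmorph_sum; apply: eq_bigr => u _; rewrite rmorph_sum; apply: eq_bigr => x _.
  by rewrite -Fp_indicator rmorph_nat.
rewrite (eq_bigr (fun u : 'I_l => \sum_h \sum_(x < b)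
    chi (h * v) * (chi (- h * (t + u%:R + x%:R)) / p%:R))); last first.
  by move=> u _; exact: exchange_big.
rewrite exchange_big mulr_suml.
apply: eq_bigr => h _ /=.
rewrite exchange_big /smooth_coef /dirichlet natrM invfM.
transitivity (\sum_(x < b) \sum_(u < l) (chi (- h) ^+ x * chi (- h) ^+ u) *
   (chi (h * v) * chi (- h * t) / p%:R / l%:R)).
  rewrite mulr_suml; apply: eq_bigr => x _; rewrite mulr_suml; apply: eq_bigr => u _ /=.
  by rewrite !mulrDr !chiD !mulr_natr !chiMn; ring.
under eq_bigr do rewrite -mulr_suml -mulr_sumr.
by rewrite -!mulr_suml; ring.
Qed.

Lemma smooth_coef0 t b l : (0 < l)%N -> smooth_coef t b l 0 = (b%:R / p%:R : R)%:C%C.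
Proof.
move=> l0; rewrite /smooth_coef oppr0 mul0r chi0 mul1r.
have d n : dirichlet n 0 = n%:R.
  rewrite /dirichlet oppr0 chi0; under eq_bigr do rewrite expr1n.
  by rewrite sumr_const card_ord.
rewrite !d (rmorphM (real_complex R)) (fmorphV (real_complex R)) !(rmorph_nat (real_complex R)).
rewrite natrM; field.
by rewrite !pnatr_eq0 -!lt0n l0 prime_gt0.
Qed.

Lemma smooth_coef_bound t b i0 a h : (i0 <= a)%N -> (b <= p)%N ->
  normc (smooth_coef t b (2 ^ i0) h) <= interval_weight i0 a h.
Proof.
move=> ia bp; have p0 : (0 : R) < p%:R by rewrite ltr0n prime_gt0.
case: (eqVneq h 0) => [->|h0].
  rewrite smooth_coef0 ?expn_gt0 // /interval_weight eqxx normc_real ger0_norm.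
    by rewrite ler_pdivrMr // mul1r ler_nat.
  by rewrite divr_ge0.
rewrite /smooth_coef /interval_weight (negPf h0) !normcM normc_chi mul1r normcV normc_nat.
rewrite natrM invfM mulrCA mulrC ler_pM2r ?invr_gt0 //.
exact: dirichlet_level_bound.
Qed.

Lemma smooth_interval_ge0 t b l v : 0 <= smooth_interval t b l v.
Proof. by rewrite divr_ge0 //; do 2 apply: sumr_ge0 => ? _. Qed.

Lemma natFp_inj (m n : nat) : (m < p)%N -> (n < p)%N -> (m%:R : Fp) = n%:R -> m = n.
Proof. by move=> mp np /(congr1 val); rewrite /= !val_Fp_nat // !modn_small. Qed.

Lemma val_Fp_lt (v : Fp) : (v < p)%N.
Proof. by have := ltn_ord v; rewrite [X in (_ < X)%N -> _]Fp_cast. Qed.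

Lemma smooth_interval_le1 t b l v : (b <= p)%N -> smooth_interval t b l v <= 1.
Proof.
move=> bp; case: (posnP l) => [->|l0]; first by rewrite /smooth_interval invr0 mulr0.
rewrite ler_pdivrMr ?ltr0n // mul1r.
have inner (u : 'I_l) : \sum_(x < b) (v == t + u%:R + x%:R)%:R <= 1 :> R.
  case: (pickP (fun x : 'I_b => v == t + u%:R + x%:R)) => [x0 /eqP e|none]; last first.
    by rewrite big1 // => x _; rewrite none.
  rewrite (bigD1 x0) //= big1 ?addr0; first by case: eqP.
  move=> x xx0; case: eqP => // ex; case/eqP: xx0; apply/val_inj/natFp_inj.
  - exact: leq_trans (ltn_ord _) bp.
  - exact: leq_trans (ltn_ord _) bp.
  - by apply: (addrI (t + u%:R)); rewrite -e -ex.
by apply: (le_trans (ler_sum _ (fun u _ => inner u))); rewrite sumr_const card_ord.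
Qed.

(** The translates of [0, b - l) by u < l stay inside [0, b), without wrapping around as b <= p. For
    b < l the truncated subtraction makes the minorant zero. *)
Lemma smooth_interval_le_indicator b l (v : Fp) : (b <= p)%N ->
  smooth_interval 0 (b - l) l v <= (v < b)%N%:R.
Proof.
move=> bp; case: ltnP => [_|bv].
  by apply: smooth_interval_le1; apply: leq_trans bp; apply: leq_subr.
rewrite /smooth_interval big1 ?mul0r // => u _; rewrite big1 // => x _.
case: eqP => // e; have ux : (u + x < b)%N by have := ltn_ord u; have := ltn_ord x; lia.
move: bv; rewrite e add0r -natrD val_Fp_nat // modn_small; last exact: leq_trans bp.
by rewrite leqNgt ux.
Qed.

(** Every translate of [- l, b) by u < l still covers [0, b). *)
Lemma indicator_le_smooth_interval b l (v : Fp) : (0 < l)%N -> (v < b)%N ->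
  1 <= smooth_interval (- l%:R) (b + l) l v.
Proof.
move=> l0 vb; rewrite /smooth_interval ler_pdivlMr ?ltr0n // mul1r.
have inner (u : 'I_l) : 1 <= \sum_(x < b + l) (v == - l%:R + u%:R + x%:R)%:R :> R.
  have xb : (v + l - u < b + l)%N by have := ltn_ord u; lia.
  rewrite (bigD1 (Ordinal xb)) //= (_ : v == _) ?lerDl; first by apply: sumr_ge0.
  rewrite -addrA -natrD subnKC; last by have := ltn_ord u; lia.
  by rewrite natrD natr_Zp addrC addrK.
apply: le_trans (ler_sum _ (fun u _ => inner u)); by rewrite sumr_const card_ord.
Qed.

Lemma smooth_interval1 b v : (b <= p)%N -> smooth_interval 0 b 1 v = (v < b)%N%:R.
Proof.
move=> bp; rewrite /smooth_interval big_ord_recl big_ord0 addr0 divr1.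
rewrite (_ : \sum_(x < b) _ = \sum_(x < b) (v == x%:R)%:R); last first.
  by apply: eq_bigr => x _; rewrite !add0r.
rewrite (sum_Fp (fun x => (v == x)%:R)) // big_mkcond /= (bigD1 v) //= big1 ?addr0.
  by rewrite eqxx; case: ltnP.
by move=> x /negPf xv; rewrite eq_sym xv; case: ifP.
Qed.

(** * Digit expansions and the discrepancy *)

Implicit Types y : nat -> Fp.

(** Digit sequences are indexed by all of [nat] and only the first k terms are read, so that [shift]
    keeps the type in inductions on k. *)
Definition digit_value (k : nat) y : R := \sum_(j < k) (y j : nat)%:R / p%:R ^+ j.+1.

Definition psi (k : nat) (h : {ffun 'I_k -> Fp}) y : R[i] := \prod_(j < k) chi (h j * y j).

Definition shift y : nat -> Fp := fun j => y j.+1.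

Lemma p_gt0 : (0 : R) < p%:R. Proof. by rewrite ltr0n prime_gt0. Qed.

Lemma digit_valueS k y : digit_value k.+1 y = ((y 0%N : nat)%:R + digit_value k (shift y)) / p%:R.
Proof.
rewrite /digit_value big_ord_recl mulrDl; congr (_ + _).
rewrite mulr_suml; apply: eq_bigr => j _; rewrite /shift lift0 exprSr invfM; ring.
Qed.

Lemma digit_value_bounds k y : 0 <= digit_value k y < 1.
Proof.
elim: k y => [|k IH] y; first by rewrite /digit_value big_ord0 lexx ltr01.
have /andP[h0 h1] := IH (shift y).
rewrite digit_valueS divr_ge0 ?addr_ge0 //= ltr_pdivrMr ?p_gt0 // mul1r.
have : ((y 0%N).+1%:R : R) <= p%:R by rewrite ler_nat val_Fp_lt.
by rewrite -natr1; lra.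
Qed.

Definition fcons (k : nat) (x : Fp) (t : {ffun 'I_k -> Fp}) : {ffun 'I_k.+1 -> Fp} :=
  [ffun j => oapp t x (unlift ord0 j)].

Definition fbehead (k : nat) (h : {ffun 'I_k.+1 -> Fp}) : {ffun 'I_k -> Fp} :=
  [ffun j => h (lift ord0 j)].

Lemma fcons0 k x t : @fcons k x t ord0 = x.
Proof. by rewrite ffunE unlift_none. Qed.

Lemma fbehead_cons k x t : fbehead (@fcons k x t) = t.
Proof. by apply/ffunP => j; rewrite !ffunE liftK. Qed.

Lemma sum_ffun_cons (V : nmodType) k (F : {ffun 'I_k.+1 -> Fp} -> V) :
  \sum_h F h = \sum_x \sum_t F (fcons x t).
Proof.
rewrite pair_big /= (reindex (fun xt : Fp * {ffun 'I_k -> Fp} => fcons xt.1 xt.2)) //.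
exists (fun h : {ffun 'I_k.+1 -> Fp} => (h ord0, fbehead h)) => [[x t]|h] _ /=.
  by rewrite fcons0 fbehead_cons.
apply/ffunP => j; rewrite ffunE; case: unliftP => [i ->|-> //].
by rewrite /= ffunE.
Qed.

Lemma psi_cons k x t y : psi (@fcons k x t) y = chi (x * y 0%N) * psi t (shift y).
Proof.
rewrite /psi big_ord_recl fcons0; congr (_ * _); apply: eq_bigr => j _.
by rewrite ffunE liftK lift0.
Qed.

Lemma psi0 k y : psi (0 : {ffun 'I_k -> Fp}) y = 1.
Proof. by rewrite /psi big1 // => j _; rewrite ffunE mul0r chi0. Qed.

Lemma fbehead0 k : fbehead (0 : {ffun 'I_k.+1 -> Fp}) = 0.
Proof. by apply/ffunP => j; rewrite !ffunE. Qed.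

(* The coefficient of the trivial character is the mean of f. *)
Definition expansion (k : nat) (w : {ffun 'I_k -> Fp} -> R) (mu : R)
    (f : (nat -> Fp) -> R) : Prop :=
  exists a : {ffun 'I_k -> Fp} -> R[i],
  [/\ a 0 = mu%:C%C, forall h, normc (a h) <= w h &
      forall y, (f y)%:C%C = \sum_h a h * psi h y].

Lemma expansion_one k (w : {ffun 'I_k -> Fp} -> R) :
  (forall h, 0 <= w h) -> 1 <= w 0 -> expansion w 1 (fun=> 1).
Proof.
move=> w0 w1; exists (fun h => (h == 0)%:R); split; first by rewrite eqxx.
  by move=> h; rewrite normc_nat; case: eqP => [->|].
move=> y; rewrite (bigD1 (0 : {ffun 'I_k -> Fp})) //= eqxx mul1r psi0 big1 ?addr0 // => h /negPf ->.
by rewrite mul0r.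
Qed.

Lemma expansion_head k i0 a t b (w : {ffun 'I_k.+1 -> Fp} -> R) :
  (i0 <= a)%N -> (b <= p)%N ->
  (forall h, 0 <= w h) ->
  (forall h, fbehead h == 0 -> interval_weight i0 a (h ord0) <= w h) ->
  expansion w (b%:R / p%:R) (fun y => smooth_interval t b (2 ^ i0) (y 0%N)).
Proof.
move=> ia bp w0 hw.
exists (fun h : {ffun 'I_k.+1 -> Fp} => smooth_coef t b (2 ^ i0) (h ord0) * (fbehead h == 0)%:R); split.
- by rewrite fbehead0 eqxx mulr1 ffunE smooth_coef0 ?expn_gt0.
- move=> h; have := hw h; case: eqP => _ => [/(_ isT) {}hw|_].
    by rewrite mulr1 (le_trans (smooth_coef_bound _ _ ia bp)).
  by rewrite mulr0 normc0.
move=> y; rewrite smooth_interval_expand sum_ffun_cons; apply: eq_bigr => x _.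
rewrite (bigD1 (0 : {ffun 'I_k -> Fp})) //= big1 ?addr0.
  by rewrite fcons0 fbehead_cons eqxx mulr1 psi_cons psi0 mulr1.
by move=> u /negPf u0; rewrite fbehead_cons u0 mulr0 mul0r.
Qed.

(** The first summand majorises the coefficients of an exact interval in the first digit, which
    involve no later digit. The second is for a point mass in the first digit, with p coefficients
    of modulus 1 / p, times a function of the tail. *)
Definition prepend_weight (k a : nat) (w : {ffun 'I_k -> Fp} -> R) (h : {ffun 'I_k.+1 -> Fp}) : R :=
  interval_weight 0 a (h ord0) * (fbehead h == 0)%:R + w (fbehead h) / p%:R.

(* x < g holds iff the first digit is below b, or equals b and the remaining digits
   form a number below g p - b. *)
Lemma expansion_prepend k a b (w : {ffun 'I_k -> Fp} -> R) mu f :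
  (b < p)%N -> expansion w mu f ->
  expansion (prepend_weight a w) ((b%:R + mu) / p%:R)
    (fun y => (y 0%N < b)%N%:R + (y 0%N == b :> nat)%:R * f (shift y)).
Proof.
move=> bp [c [c0 cw cf]].
exists (fun h : {ffun 'I_k.+1 -> Fp} => smooth_coef 0 b 1 (h ord0) * (fbehead h == 0)%:R
                 + chi (- (h ord0) * b%:R) / p%:R * c (fbehead h)); split.
- rewrite fbehead0 eqxx ffunE smooth_coef0 // oppr0 mul0r chi0 c0 mulr1.
  rewrite mul1r mulrDl (rmorphD (real_complex R)); congr (_ + _).
  by rewrite mulrC (rmorphM (real_complex R)) (fmorphV (real_complex R)) (rmorph_nat (real_complex R)).
- move=> h; apply: (le_trans (normcD _ _)); apply: lerD.
    rewrite normcM normc_nat ler_wpM2r //.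
    exact: (@smooth_coef_bound 0 b 0 a _ (leq0n a) (ltnW bp)).
  rewrite !normcM normc_chi mul1r normcV normc_nat mulrC ler_pM2r ?invr_gt0 ?p_gt0 //.
move=> y; rewrite rmorphD rmorphM /= cf.
rewrite -(smooth_interval1 _ (ltnW bp)) smooth_interval_expand.
have -> : ((y 0%N == b :> nat)%:R : R)%:C%C = (y 0%N == b%:R)%:R.
  rewrite rmorph_nat; congr (nat_of_bool _)%:R.
  by apply/eqP/eqP => [<-|->]; rewrite ?natr_Zp // val_Fp_nat // modn_small.
rewrite Fp_indicator mulr_suml -big_split /= sum_ffun_cons; apply: eq_bigr => x _.
rewrite [RHS](eq_bigr (fun t : {ffun 'I_k -> Fp} =>
    smooth_coef 0 b 1 x * (t == 0)%:R * (chi (x * y 0%N) * psi t (shift y))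
    + chi (- x * b%:R) / p%:R * c t * (chi (x * y 0%N) * psi t (shift y)))); last first.
  by move=> t _; rewrite fcons0 fbehead_cons psi_cons mulrDl.
rewrite big_split /=; congr (_ + _).
  rewrite (bigD1 (0 : {ffun 'I_k -> Fp})) //= eqxx big1 ?addr0 ?mulr1 ?psi0 ?mulr1 // => u /negPf ->.
  by rewrite mulr0 mul0r.
by rewrite mulr_sumr; apply: eq_bigr => t _; ring.
Qed.

Lemma prepend_weight_ge0 k a (w : {ffun 'I_k -> Fp} -> R) h :
  (forall t, 0 <= w t) -> 0 <= prepend_weight a w h.
Proof.
move=> w0; apply: addr_ge0; first by rewrite mulr_ge0 ?interval_weight_ge0.
by rewrite divr_ge0.
Qed.

(** The p coefficients 1 / p of the point mass add up to 1, so the weight of the tail is added and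
    not multiplied. This is why the total weight grows linearly in the number of exact digits. *)
Lemma sum_prepend_weight k a (w : {ffun 'I_k -> Fp} -> R) :
  \sum_h prepend_weight a w h = \sum_x interval_weight 0 a x + \sum_t w t.
Proof.
rewrite sum_ffun_cons.
rewrite (eq_bigr (fun x => interval_weight 0 a x + (\sum_t w t) / p%:R)); last first.
  move=> x _; rewrite (eq_bigr (fun t : {ffun 'I_k -> Fp} =>
      interval_weight 0 a x * (t == 0)%:R + w t / p%:R)); last first.
    by move=> t _; rewrite /prepend_weight fcons0 fbehead_cons.
  rewrite big_split /= -mulr_suml; congr (_ + _).
  rewrite (bigD1 (0 : {ffun 'I_k -> Fp})) //= eqxx mulr1 big1 ?addr0 // => u /negPf ->.
  by rewrite mulr0.
rewrite big_split /= sumr_const card_Fp //; congr (_ + _).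
by rewrite -[LHS]mulr_natr divfK // gt_eqF ?p_gt0.
Qed.

(** A minorant and a majorant of the threshold indicator, with means close to g. The positivity of
    [fl] and the bounds of the means by 0 and 1 allow products over the coordinates to be taken. *)
Definition brackets k (w : {ffun 'I_k -> Fp} -> R) (g err : R) : Prop :=
  exists fl ml fu mu,
  [/\ expansion w ml fl, expansion w mu fu,
      forall y, 0 <= fl y <= (digit_value k y < g)%R%:R /\ (digit_value k y < g)%R%:R <= fu y,
      (0 <= ml <= 1 /\ 0 <= mu <= 1) & (`|ml - g| <= err /\ `|mu - g| <= err)].

Lemma brackets_one k (w : {ffun 'I_k -> Fp} -> R) err :
  (forall h, 0 <= w h) -> 1 <= w 0 -> 0 <= err -> brackets w 1 err.
Proof.
move=> w0 w1 e0; have ew := expansion_one w0 w1.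
exists (fun=> 1), 1, (fun=> 1), 1; split=> //.
- move=> y; have /andP[_ ->] := digit_value_bounds k y.
  by rewrite ler01 lexx.
- by rewrite ler01 lexx.
- by rewrite subrr normr0.
Qed.

Lemma ler_dist_div (x g e : R) : (`|x / p%:R - g| <= e / p%:R) = (`|x - g * p%:R| <= e).
Proof.
have pR := p_gt0; have -> : x / p%:R - g = (x - g * p%:R) / p%:R.
  by rewrite mulrBl mulfK ?gt_eqF.
by rewrite normrM normfV (ger0_norm (ltW pR)) ler_pM2r ?invr_gt0.
Qed.

(** A first digit below b puts the value below g, and a value below g forces a first digit at most
    b. In the error (2^i0 + 1) / p the part 2^i0 is due to smoothing and 1 to ignoring the later
    digits. *)
Lemma digit_brackets_base k i0 a : (i0 <= a)%N -> (2 ^ a <= p < 2 ^ a.+1)%N ->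
  exists w : {ffun 'I_k.+1 -> Fp} -> R,
  [/\ forall h, 0 <= w h, 1 <= w 0, \sum_h w h <= (a - i0)%N%:R + 9 &
      forall g, 0 <= g <= 1 -> brackets w g ((2 ^ i0)%N.+1%:R / p%:R)].
Proof.
move=> ia pa; pose w (h : {ffun 'I_k.+1 -> Fp}) :=
  interval_weight i0 a (h ord0) * (fbehead h == 0)%:R.
have w0 h : 0 <= w h by rewrite mulr_ge0 ?interval_weight_ge0.
have w1 : 1 <= w 0 by rewrite /w fbehead0 eqxx mulr1 ffunE /interval_weight eqxx.
exists w; split=> //.
  rewrite sum_ffun_cons; apply: le_trans (sum_interval_weight i0 pa).
  apply: ler_sum => x _; rewrite (bigD1 (0 : {ffun 'I_k -> Fp})) //= big1 ?addr0.
    by rewrite /w fcons0 fbehead_cons eqxx mulr1.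
  by move=> t /negPf t0; rewrite /w fbehead_cons t0 mulr0.
have pR := p_gt0; have p0 : p%:R != 0 :> R by rewrite gt_eqF.
move=> g /andP[g0 g1]; pose b := Num.truncn (g * p%:R).
have /truncn_itv/andP : 0 <= g * p%:R by rewrite mulr_ge0 // ltW.
rewrite -/b => -[bg gb].
have bp : (b <= p)%N.
  by rewrite -(ler_nat R) (le_trans bg) // -[X in _ <= X]mul1r ler_wpM2r // ltW.
have hw h : fbehead h == 0 -> interval_weight i0 a (h ord0) <= w h.
  by move=> e; rewrite /w e mulr1.
set l := (2 ^ i0)%N; have l0 : (0 < l)%N by rewrite expn_gt0.
have valy y : digit_value k.+1 y * p%:R = (y 0%N : nat)%:R + digit_value k (shift y).
  by rewrite digit_valueS divfK.
have lowP y : (y 0%N < b)%N -> digit_value k.+1 y < g.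
  move=> yb; rewrite -(ltr_pM2r pR) valy; have /andP[_ h1] := digit_value_bounds k (shift y).
  have : ((y 0%N).+1%:R : R) <= b%:R by rewrite ler_nat.
  by rewrite -natr1; lra.
have upP y : digit_value k.+1 y < g -> (y 0%N < b.+1)%N.
  rewrite -(ltr_pM2r pR) valy; have /andP[h0 _] := digit_value_bounds k (shift y).
  by move=> h; rewrite -(ltr_nat R); lra.
have lowf := expansion_head 0 ia (leq_trans (leq_subr l b) bp) w0 hw.
have lowm : (b - l)%N%:R <= b%:R :> R /\ b%:R <= (b - l)%N%:R + l%:R :> R.
  by rewrite -natrD !ler_nat leq_subr addnC -leq_subLR leqnn.
have bgap : `|(b - l)%N%:R / p%:R - g| <= l.+1%:R / p%:R.
  rewrite ler_dist_div ler_norml -[l.+1%:R]natr1; rewrite -natr1 in gb.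
  by apply/andP; split; lra.
have lowb y : 0 <= smooth_interval 0 (b - l) l (y 0%N) <= (digit_value k.+1 y < g)%R%:R.
  rewrite smooth_interval_ge0 /= (le_trans (smooth_interval_le_indicator _ _ bp)) //.
  by case: ltnP => // yb; rewrite lowP.
have lowm01 : 0 <= ((b - l)%N%:R : R) / p%:R <= 1.
    apply/andP; split; first exact: divr_ge0.
  by rewrite ler_pdivrMr // mul1r ler_nat (leq_trans (leq_subr _ _)).
(* An enlarged interval longer than p is outside the range of [expansion_head]; then g is within (l
   + 1) / p of 1, and the constant 1 serves as majorant. *)
case: (leqP (b.+1 + l) p) => hbp.
  have upf := expansion_head (- l%:R) ia hbp w0 hw.
  exists (fun y => smooth_interval 0 (b - l) l (y 0%N)), ((b - l)%N%:R / p%:R).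
  exists (fun y => smooth_interval (- l%:R) (b.+1 + l) l (y 0%N)), ((b.+1 + l)%N%:R / p%:R).
  split=> //.
  - move=> y; split; first exact: lowb.
    case: ltP => [/upP h|_]; last exact: smooth_interval_ge0.
    exact: indicator_le_smooth_interval.
  - split=> //; apply/andP; split; first exact: divr_ge0.
    by rewrite ler_pdivrMr // mul1r ler_nat.
  - split=> //; rewrite ler_dist_div ler_norml natrD -[l.+1%:R]natr1 -[b.+1%:R]natr1.
    by rewrite -natr1 in gb; apply/andP; split; lra.
exists (fun y => smooth_interval 0 (b - l) l (y 0%N)), ((b - l)%N%:R / p%:R), (fun=> 1), 1.
split=> //.
- exact: expansion_one.
- by move=> y; split; [exact: lowb | case: ltP].
- by split=> //; rewrite ler01 lexx.
- split=> //; rewrite ger0_norm ?subr_ge0 // -(ler_pM2r pR) divfK // mulrBl mul1r.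
  move: hbp; rewrite -(ltr_nat R) natrD -natr1 => hbp; rewrite -natr1; lra.
Qed.

(** Built from the inside: the smoothed digit is the base case, each step puts one exact digit in
    front and divides the error by p. The k digits after the smoothed one are ignored. *)
Lemma digit_brackets J k i0 a : (i0 <= a)%N -> (2 ^ a <= p < 2 ^ a.+1)%N ->
  exists w : {ffun 'I_(J + k).+1 -> Fp} -> R,
  [/\ forall h, 0 <= w h, 1 <= w 0,
      \sum_h w h <= (J * (a + 9) + (a - i0) + 9)%N%:R &
      forall g, 0 <= g <= 1 -> brackets w g ((2 ^ i0)%N.+1%:R / p%:R ^+ J.+1)].
Proof.
move=> ia pa; elim: J => [|J [w [w0 w1 sw bw]]].
  have [w [w0 w1 sw bw]] := digit_brackets_base k ia pa.
  by exists w; split=> //; apply: (le_trans sw); rewrite -natrD ler_nat; lia.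
exists (prepend_weight a w); split.
- by move=> h; apply: prepend_weight_ge0.
- rewrite /prepend_weight fbehead0 eqxx ffunE /interval_weight eqxx mul1r lerDl.
  by rewrite divr_ge0.
- rewrite sum_prepend_weight.
  rewrite (_ : J.+1 * (a + 9) + _ + 9 = (a + 9) + (J * (a + 9) + (a - i0) + 9))%N; last lia.
  rewrite natrD; apply: lerD => //.
  by apply: (le_trans (sum_interval_weight 0 pa)); rewrite subn0 natrD.
have pR := p_gt0; have p0 : p%:R != 0 :> R by rewrite gt_eqF.
(* For g = 1 the leading digit b chosen below would be p, which [expansion_prepend] excludes. *)
move=> g /andP[g0]; rewrite le_eqVlt => /orP[/eqP->|g1].
  apply: brackets_one.
  - by move=> h; apply: prepend_weight_ge0.
  - rewrite /prepend_weight fbehead0 eqxx ffunE /interval_weight eqxx mul1r lerDl.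
    by rewrite divr_ge0.
  - by rewrite divr_ge0 ?exprn_ge0.
pose b := Num.truncn (g * p%:R).
have /truncn_itv/andP : 0 <= g * p%:R by rewrite mulr_ge0 // ltW.
rewrite -/b => -[bg gb].
have bp : (b < p)%N.
  by rewrite -(ltr_nat R) (le_lt_trans bg) // -[X in _ < X]mul1r ltr_pM2r.
have [|fl [ml [fu [mu [el eu fb [mlb mub] [dl du]]]]]] := bw (g * p%:R - b%:R).
  by rewrite -natr1 in gb; apply/andP; split; lra.
have step (m : R) : 0 <= m <= 1 -> 0 <= (b%:R + m) / p%:R <= 1.
  move=> /andP[m0 m1]; apply/andP; split; first by rewrite divr_ge0 ?addr_ge0.
  rewrite ler_pdivrMr // mul1r.
  have : (b.+1%:R : R) <= p%:R by rewrite ler_nat.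
  by rewrite -natr1; lra.
have stepd (m : R) : `|m - (g * p%:R - b%:R)| <= (2 ^ i0)%N.+1%:R / p%:R ^+ J.+1 ->
  `|(b%:R + m) / p%:R - g| <= (2 ^ i0)%N.+1%:R / p%:R ^+ J.+2.
  move=> h; rewrite [p%:R ^+ J.+2]exprSr invfM [X in _ <= X]mulrA ler_dist_div.
  by rewrite (_ : _ - _ = m - (g * p%:R - b%:R)) //; ring.
exists (fun y => (y 0%N < b)%N%:R + (y 0%N == b :> nat)%:R * fl (shift y)), ((b%:R + ml) / p%:R).
exists (fun y => (y 0%N < b)%N%:R + (y 0%N == b :> nat)%:R * fu (shift y)), ((b%:R + mu) / p%:R).
split; try exact: expansion_prepend.
- move=> y; have [/andP[l0 l1] u] := fb (shift y).
  have e : digit_value (J.+1 + k).+1 y < g = ((y 0%N : nat)%:R + digit_value (J + k).+1 (shift y) < g * p%:R).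
    by rewrite -(ltr_pM2r pR) digit_valueS divfK.
  have /andP[v0 v1] := digit_value_bounds (J + k).+1 (shift y).
  rewrite e; case: (ltngtP (y 0%N) b) => [yb|by_|yb].
  + have : ((y 0%N).+1%:R : R) <= b%:R by rewrite ler_nat.
    rewrite -natr1 => h; rewrite !mul0r !addr0 (_ : (_ < _) = true); last by lra.
    by rewrite ler01 lexx.
  + have : ((b.+1)%:R : R) <= (y 0%N)%:R by rewrite ler_nat.
    move=> h; rewrite !mul0r !addr0 (_ : (_ < _) = false) ?lexx //.
    by apply/negbTE; rewrite -leNgt; lra.
  + rewrite !add0r !mul1r yb (_ : (_ < _) = (digit_value (J + k).+1 (shift y) < g * p%:R - b%:R)).
      by rewrite l0 l1 u.
    by rewrite addrC ltrBrDr.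
- by split; apply: step.
- by split; apply: stepd.
Qed.

(* J exact digits and a last digit smoothed at scale 2^i0 give resolution 2^-mu; the
   number of dyadic levels used is O(mu), uniformly in p. *)
Lemma digit_scale_exists (k mu : nat) : (0 < k)%N -> (2 ^ mu <= p ^ k)%N ->
  exists J i0 a, [/\ (i0 <= a)%N, (2 ^ a <= p < 2 ^ a.+1)%N, (J < k)%N,
    (2 ^ i0 * 2 ^ mu <= p ^ J.+1)%N & (J * (a + 9) + (a - i0) + 9 <= 11 * mu.+1)%N].
Proof.
move=> k0 muk; have p1 := prime_gt1 p_pr.
have exJ : exists n, (2 ^ mu <= p ^ n.+1)%N by exists k.-1; rewrite prednK.
case: (ex_minnP exJ) => J hJ minJ; have Jk : (J < k)%N.
  by have := minJ k.-1; rewrite prednK // => /(_ muk); lia.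
have pJ : (p ^ J <= 2 ^ mu)%N.
  case: J {hJ Jk} minJ => [_|J minJ]; first by rewrite expn0 expn_gt0.
  by rewrite leqNgt; apply/negP => /ltnW /minJ; rewrite ltnn.
pose a := trunc_log 2 p; have a1 : (2 ^ a <= p)%N by apply: trunc_logP; lia.
have a2 : (p < 2 ^ a.+1)%N by apply: trunc_log_ltn.
pose v := (p ^ J.+1 %/ 2 ^ mu)%N; have v0 : (0 < v)%N by rewrite divn_gt0 ?expn_gt0.
pose i0 := trunc_log 2 v; have i1 : (2 ^ i0 <= v)%N by exact: trunc_logP.
have i2 : (v < 2 ^ i0.+1)%N by exact: trunc_log_ltn.
have e1 : (2 ^ i0 * 2 ^ mu <= p ^ J.+1)%N by rewrite -leq_divRL ?expn_gt0.
have e2 : (p ^ J.+1 < 2 ^ (i0.+1 + mu))%N by rewrite expnD -ltn_divLR ?expn_gt0.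
have ia : (i0 < a.+1)%N.
  rewrite -(ltn_exp2l (m := 2)) //; apply: leq_ltn_trans a2.
  rewrite -(leq_pmul2r (m := 2 ^ mu)) ?expn_gt0 // (leq_trans e1) // expnS.
  by rewrite leq_mul2l pJ orbT.
have ai : (a < i0.+1 + mu)%N.
  rewrite -(ltn_exp2l (m := 2)) //; apply: leq_ltn_trans e2.
  by rewrite (leq_trans a1) // -[X in (X <= _)%N]expn1 leq_pexp2l //; lia.
have aJ : (a * J <= mu)%N.
  rewrite -(leq_exp2l (m := 2)) // expnM (leq_trans _ pJ) //.
  by case: (J) => // n; rewrite leq_exp2r.
have Jmu : (J <= mu)%N.
  rewrite -(leq_exp2l (m := 2)) // (leq_trans _ pJ) //.
  by case: (J) => // n; rewrite leq_exp2r.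
exists J, i0, a; split=> //; [by rewrite a1 a2|].
(* By [aJ], [Jmu] and [ai] the count is at most mu + 9 mu + mu + 9, whence the factor 11. *)
by rewrite mulnDr [(J * a)%N]mulnC; lia.
Qed.

Lemma digit_brackets_scale (k mu : nat) : (0 < k)%N -> (2 ^ mu <= p ^ k)%N ->
  exists w : {ffun 'I_k -> Fp} -> R,
  [/\ forall h, 0 <= w h, \sum_h w h <= (11 * mu.+1)%N%:R &
      forall g, 0 <= g <= 1 -> brackets w g (2 / 2 ^+ mu)].
Proof.
move=> k0 muk; have [J [i0 [a [ia pa Jk e1 e2]]]] := digit_scale_exists k0 muk.
have [k' ek] : exists k', k = (J + k').+1 by exists (k - J.+1)%N; lia.
subst k; have [w [w0 w1 sw bw]] := digit_brackets J k' ia pa.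
exists w; split=> //; first by apply: (le_trans sw); rewrite ler_nat.
move=> g g01; have [fl [ml [fu [mu' [h1 h2 h3 h4 [h5 h6]]]]]] := bw g g01.
have err : (2 ^ i0)%N.+1%:R / p%:R ^+ J.+1 <= 2 / 2 ^+ mu :> R.
  rewrite ler_pdivrMr ?exprn_gt0 ?p_gt0 // mulrAC ler_pdivlMr ?exprn_gt0 //.
  rewrite -!natrX -!natrM ler_nat.
  have : (0 < 2 ^ i0)%N by rewrite expn_gt0.
  move: e1; move: (2 ^ i0)%N (2 ^ mu)%N (p ^ J.+1)%N => x y v e1 x0.
  by rewrite mulSn; have := leq_pmull y x0; clear -e1; lia.
by exists fl, ml, fu, mu'; split=> //; split; apply: le_trans err.
Qed.

(** * Boxes in several coordinates and the Fourier bound for the discrepancy *)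

Section Box.

Variables (I : finType) (k : nat).
Implicit Types (H : {ffun I -> {ffun 'I_k -> Fp}}) (Y : I -> nat -> Fp).

Definition multi_psi H Y : R[i] := \prod_i psi (H i) (Y i).

Lemma multi_expansion (w : {ffun 'I_k -> Fp} -> R) (m : I -> R) (f : I -> (nat -> Fp) -> R) :
  (forall i, expansion w (m i) (f i)) ->
  exists A : {ffun I -> {ffun 'I_k -> Fp}} -> R[i],
  [/\ A 0 = (\prod_i m i)%:C%C, forall H, normc (A H) <= \prod_i w (H i) &
      forall Y, (\prod_i f i (Y i))%:C%C = \sum_H A H * multi_psi H Y].
Proof.
move=> /boolp.choice[a ha]; exists (fun H => \prod_i a i (H i)); split.
- rewrite rmorph_prod; apply: eq_bigr => i _.
  by rewrite ffunE; case: (ha i).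
- move=> H; rewrite normc_prod; apply: ler_prod => i _.
  by rewrite normc_ge0; have [_ -> _] := ha i.
move=> Y; rewrite rmorph_prod.
rewrite (eq_bigr (fun i => \sum_h a i h * psi h (Y i))); last first.
  by move=> i _; case: (ha i) => _ _ h; exact: h.
by rewrite bigA_distr_bigA /=; apply: eq_bigr => H _; rewrite big_split.
Qed.

Lemma multi_mean (T : finType) (z : T -> I -> nat -> Fp)
    (w : {ffun 'I_k -> Fp} -> R) (m : I -> R) (f : I -> (nat -> Fp) -> R) :
  (forall i, expansion w (m i) (f i)) ->
  `|\sum_t \prod_i f i (z t i) - #|T|%:R * \prod_i m i| <=
  \sum_(H : {ffun I -> {ffun 'I_k -> Fp}} | H != 0) (\prod_i w (H i)) * normc (\sum_t multi_psi H (z t)).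
Proof.
move=> /multi_expansion[A [A0 Aw Af]].
rewrite -normc_real (rmorphB (real_complex R)) (rmorphM (real_complex R)).
rewrite (rmorph_nat (real_complex R)) (rmorph_sum (real_complex R)).
rewrite (_ : \sum_t _ = \sum_H A H * \sum_t multi_psi H (z t)); last first.
  rewrite (eq_bigr (fun t => \sum_H A H * multi_psi H (z t))); last by move=> t _; exact: Af.
  by rewrite exchange_big; apply: eq_bigr => H _; rewrite mulr_sumr.
rewrite (bigD1 (0 : {ffun I -> {ffun 'I_k -> Fp}})) //= A0.
rewrite (_ : \sum_t multi_psi (0 : {ffun I -> {ffun 'I_k -> Fp}}) (z t) = #|T|%:R); last first.
  rewrite (eq_bigr (fun=> 1)) ?sumr_const // => t _.
  by rewrite /multi_psi big1 // => i _; rewrite ffunE psi0.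
rewrite [_%:R * _]mulrC addrAC subrr add0r.
apply: (le_trans (normc_sum _ _ _)); apply: ler_sum => H _.
by rewrite normcM ler_wpM2r ?normc_ge0.
Qed.

End Box.

Lemma prod_dist (I : finType) (a b : I -> R) :
  (forall i, 0 <= a i <= 1) -> (forall i, 0 <= b i <= 1) ->
  `|\prod_i a i - \prod_i b i| <= \sum_i `|a i - b i|.
Proof.
move=> ha hb.
suff : 0 <= \prod_i a i <= 1 /\ `|\prod_i a i - \prod_i b i| <= \sum_i `|a i - b i| by case.
elim: (index_enum I) => [|i s]; first by rewrite !big_nil subrr normr0 ler01 lexx.
rewrite !big_cons; set v := \prod_(_ <- s) a _; set x := \prod_(_ <- s) b _ => -[/andP[v0 v1] h].
have /andP[a0 a1] := ha i; have /andP[b0 b1] := hb i; split.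
  by rewrite mulr_ge0 //= mulr_ile1.
rewrite (_ : a i * v - b i * x = (a i - b i) * v + b i * (v - x)); last by ring.
apply: (le_trans (ler_normD _ _)); rewrite !normrM; apply: lerD.
  by rewrite ler_piMr // ger0_norm.
by rewrite (le_trans _ h) // ler_piMl // ger0_norm.
Qed.

(** The weight W is chosen before the points and dominates the coefficients of the brackets of every
    box. The supremum over boxes is thereby absorbed, and one weighted sum over H is left to be
    averaged. *)
Lemma discrepancy_fourier (I : finType) (k mu : nat) :
  (0 < k)%N -> (2 ^ mu <= p ^ k)%N ->
  exists W : {ffun I -> {ffun 'I_k -> Fp}} -> R,
  [/\ forall H, 0 <= W H, \sum_H W H <= (11 * mu.+1)%N%:R ^+ #|I| &
    forall (T : finType) (z : T -> I -> nat -> Fp), (0 < #|T|)%N ->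
    discrepancy (fun t i => digit_value k (z t i)) <=
      #|I|%:R * (2 / 2 ^+ mu) +
      (\sum_(H : {ffun I -> {ffun 'I_k -> Fp}} | H != 0) W H * normc (\sum_t multi_psi H (z t))) / #|T|%:R].
Proof.
move=> k0 muk; have [w [w0 sw bw]] := digit_brackets_scale k0 muk.
exists (fun H => \prod_i w (H i)); split.
- by move=> H; apply: prodr_ge0.
- rewrite -(bigA_distr_bigA (fun=> w)) prodr_const; apply: lerXn2r; rewrite ?nnegrE //.
  by apply: sumr_ge0.
move=> T z T0; set E := \sum_(H | _) _.
have T0R : (0 : R) < #|T|%:R by rewrite ltr0n.
have T0' : #|T|%:R != 0 :> R by rewrite gt_eqF.
apply: ge_sup.
  by eexists; exists (fun=> 1); [move=> i; rewrite ltr01 lexx | reflexivity].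
move=> _ [g hg ->].
have /boolp.choice[F hF] i : exists F : ((nat -> Fp) -> R) * R * ((nat -> Fp) -> R) * R,
  [/\ expansion w F.1.1.2 F.1.1.1, expansion w F.2 F.1.2,
      forall y, 0 <= F.1.1.1 y <= (digit_value k y < g i)%R%:R
         /\ (digit_value k y < g i)%R%:R <= F.1.2 y,
      (0 <= F.1.1.2 <= 1 /\ 0 <= F.2 <= 1) &
      (`|F.1.1.2 - g i| <= 2 / 2 ^+ mu /\ `|F.2 - g i| <= 2 / 2 ^+ mu)].
  have g01 : 0 <= g i <= 1 by have /andP[/ltW -> ->] := hg i.
  by have [fl [ml [fu [mu' h]]]] := bw _ g01; exists (fl, ml, fu, mu').
have g01 i : 0 <= g i <= 1 by have /andP[/ltW -> ->] := hg i.
have cnt : #|[set t | [forall i, 0 <= digit_value k (z t i) < g i]]%classic|%:R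
    = \sum_t \prod_i (digit_value k (z t i) < g i)%R%:R :> R.
  rewrite -sum1_card natr_sum big_mkcond /=; apply: eq_bigr => t _.
  rewrite (_ : (t \in _) = [forall i, 0 <= digit_value k (z t i) < g i]); last first.
    by apply/idP/idP; rewrite in_setE.
  case: ifP => [/forallP h|/negbT].
    by rewrite big1 // => i _; have /andP[_ ->] := h i.
  rewrite negb_forall => /existsP[i hi]; rewrite (bigD1 i) //=.
  by have /andP[h0 _] := digit_value_bounds k (z t i); move: hi; rewrite h0 /= => /negPf ->; rewrite mul0r.
have eL (i : I) : expansion w (F i).1.1.2 (F i).1.1.1 by have [] := hF i.
have eU (i : I) : expansion w (F i).2 (F i).1.2 by have [] := hF i.
have := multi_mean z eL; have := multi_mean z eU; rewrite -/E.
set U := \sum_t _; set L := \sum_t _; move=> hU hL.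
have cL : L <= \sum_t \prod_i (digit_value k (z t i) < g i)%R%:R.
  by apply: ler_sum => t _; apply: ler_prod => i _; have [_ _ /(_ (z t i))[]] := hF i.
have cU : \sum_t \prod_i (digit_value k (z t i) < g i)%R%:R <= U.
  by apply: ler_sum => t _; apply: ler_prod => i _; rewrite ler0n /=; have [_ _ /(_ (z t i))[]] := hF i.
have near (m : I -> R) : (forall i, 0 <= m i <= 1) -> (forall i, `|m i - g i| <= 2 / 2 ^+ mu) ->
  `|\prod_i m i - \prod_i g i| <= #|I|%:R * (2 / 2 ^+ mu).
  move=> m01 mg; apply: (le_trans (prod_dist m01 g01)).
  apply: (le_trans (ler_sum _ (fun i _ => mg i))); by rewrite sumr_const [X in _ <= X]mulr_natl lexx.
have nL := near (fun i => (F i).1.1.2) (fun i => let: And5 _ _ _ (conj a _) _ := hF i in a)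
   (fun i => let: And5 _ _ _ _ (conj a _) := hF i in a).
have nU := near (fun i => (F i).2) (fun i => let: And5 _ _ _ (conj _ a) _ := hF i in a)
   (fun i => let: And5 _ _ _ _ (conj _ a) := hF i in a).
rewrite cnt; set S := \sum_t _ in cL cU *.
move: hU hL nL nU; set pU := \prod_i (F i).2; set pL := \prod_i (F i).1.1.2; set G := \prod_i g i.
set d := _ * (2 / _) => hU hL nL nU.
rewrite -(ler_pM2r T0R) mulrDl divfK // -[X in `|_| * X](ger0_norm (ltW T0R)) -normrM mulrBl divfK //.
move: hU hL nL nU; rewrite !ler_norml => /andP[a1 a2] /andP[a3 a4] /andP[a5 a6] /andP[a7 a8].
have b1 : (pU - G) * #|T|%:R <= d * #|T|%:R by rewrite ler_pM2r.
have b2 : - d * #|T|%:R <= (pL - G) * #|T|%:R by rewrite ler_pM2r.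
by apply/andP; split; lra.
Qed.

End PrimeFieldCharacter.

(** * Exponential sums over the net *)

Section AbsoluteTraceTheory.

Variables (p : nat) (F : finFieldType) (chF : p \in [pchar F]).

Local Notation L := (pPrimeCharType chF).

Lemma absTr_injA : injective (fun a : 'F_p => a%:A : L).
Proof. exact: (fmorph_inj (in_alg L)). Qed.

Lemma absTrD : {morph absTr chF : x y / x + y}.
Proof.
move=> x y; apply: absTr_injA => /=; rewrite scalerDl !absTrE.
exact: (raddfD (galTrace 1%AS {:L})).
Qed.

Lemma absTrMn x n : absTr chF (x *+ n) = absTr chF x *+ n.
Proof.
have h0 : absTr chF 0 = 0 by apply: (addrI (absTr chF 0)); rewrite -absTrD !addr0.
by elim: n => [|n IH]; rewrite ?mulr0n // !mulrS absTrD IH.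
Qed.

(** A vanishing trace would be a linear relation, with all coefficients 1, between distinct
    automorphisms, against Dedekind independence. *)
Lemma absTr_nontrivial : exists x, absTr chF x != 0.
Proof.
case: (boolP [exists x, absTr chF x != 0]) => [/existsP //|].
rewrite negb_exists => /forallP h; exfalso.
have tr0 x : galTrace 1%AS {:L} (x : L) = 0.
  by rewrite -absTrE; move/negPn: (h x) => /eqP ->; rewrite scale0r.
have : (1 : L) = 0.
  apply: (@gal_independent _ _ {:L} (fun g => g \in ('Gal({:L} / 1))%g) (fun=> 1) _ 1%g
    (fingroup.group1 _)) => x _.
  by rewrite -[RHS](tr0 x) /galTrace; apply: eq_bigr => g _; rewrite mul1r.
by move/eqP; rewrite oner_eq0.
Qed.

End AbsoluteTraceTheory.

Lemma card_primitive_roots (F : finFieldType) (n : nat) : #|F| = n.+1 -> (0 < n)%N ->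
  #|[set b : F | n.-primitive_root b]| = totient n.
Proof.
move=> cF n0.
have [z zP] : exists z : F, n.-primitive_root z.
  have : has n.-primitive_root [seq x <- enum F | x != 0].
    apply: cyclic.has_prim_root => //.
    - apply/allP => x; rewrite mem_filter => /andP[x0 _]; apply/unity_rootP.
      by apply: (mulfI x0); rewrite -exprS -cF finfield.expf_card mulr1.
    - by rewrite filter_uniq ?enum_uniq.
    rewrite size_filter; have := count_predC (fun x : F => x != 0) (enum F).
    rewrite -cardE cF (_ : count (predC _) _ = 1%N) ?addn1; first by move=> [->].
    rewrite (eq_count (a2 := pred1 0)) ?count_uniq_mem ?enum_uniq ?mem_enum //.
    by move=> x /=; rewrite negbK.
  by case/hasP => z _ zP; exists z.
rewrite totient_count_coprime big_mkord -sum1_card.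
rewrite (eq_bigr (fun i : 'I_n => if coprime i n then 1%N else 0%N)); last first.
  by move=> i _; rewrite coprime_sym; case: coprime.
rewrite -big_mkcond /= !sum1_card.
pose f (i : 'I_n) := z ^+ i.
have finj : injective f.
  move=> i j /eqP; rewrite /f (eq_prim_root_expr zP) !modn_small // => /eqP h.
  exact: val_inj.
rewrite -[RHS](card_imset _ finj); apply: eq_card => b.
apply/idP/imsetP => [|[i ci ->]]; last by rewrite inE prim_root_exp_coprime.
rewrite inE => bP; have [i ei] := prim_rootP zP (prim_expr_order bP).
by exists i; rewrite // -[_ \in _]/(coprime i n) -(prim_root_exp_coprime _ zP) -ei.
Qed.

Lemma totient_le (n : nat) : (totient n <= n)%N.
Proof.
rewrite totient_count_coprime -[X in (_ <= X)%N]subn0 -[X in (_ <= X)%N]muln1.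
rewrite -sum_nat_const_nat; apply: leq_sum => i _; exact: leq_b1.
Qed.

Section ExponentialSums.

Variables (p k r s : nat) (F : finFieldType) (chF : p \in [pchar F]).
Variables (S : {ffun 'I_r.+1 -> nat}).
Hypotheses (p_pr : prime p) (k_gt0 : (0 < k)%N) (s_gt0 : (0 < s)%N).
Hypothesis S_le : forall w, (S w <= s)%N.
Hypothesis card_F : #|F| = (p ^ k)%N.

Local Notation Fp := 'F_p.
Local Notation Box := {dffun forall w : 'I_r.+1, 'I_(S w)}.
Local Notation q := (p ^ k)%N.
Implicit Types (H : {ffun Box -> {ffun 'I_k -> Fp}}) (n : 'I_r.+1 -> nat) (i : Box).

Definition trace_digit (alpha beta : {ffun 'I_r.+1 -> F}) n (j : nat) : Fp :=
  \sum_w absTr chF (alpha w * beta w ^+ (k * (n w + s * ntilde s n w) + j)).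

Lemma trace_digitE alpha beta n j :
  ydigit k s chF alpha beta n j = trace_digit alpha beta n j :> nat.
Proof.
rewrite /ydigit /trace_digit -val_Fp_nat //; congr (nat_of_ord _).
by rewrite natr_sum; apply: eq_bigr => w _; rewrite natr_Zp.
Qed.

(** The part of the exponent due to the shift i when c is the residue [ntilde] at the base point;
    the other coordinates of n enter only through c. As the dimension is r.+1, the modulus is
    [s ^ r]. *)
Definition shift_exp (w : 'I_r.+1) (c : nat) i : nat :=
  i w + s * ((c + \sum_(v < r.+1 | v != w) i v * s ^ dexp v w) %% s ^ r).

Lemma ntilde_shift n i w :
  ((n w + i w) + s * ntilde s (fun v => n v + i v) w =
   n w + shift_exp w (ntilde s n w) i)%N.
Proof.
rewrite /shift_exp -addnA; congr (_ + (_ + s * _))%N.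
rewrite /ntilde modnDml -big_split /=; congr (_ %% _)%N.
by apply: eq_bigr => v _; rewrite mulnDl.
Qed.

Lemma box_lt i w : (i w < s)%N.
Proof. exact: leq_trans (ltn_ord _) (S_le w). Qed.

Lemma sum_dexp (w : 'I_r.+1) (f : 'I_r.+1 -> nat) :
  (\sum_(v < r.+1 | v != w) f v * s ^ dexp v w = \sum_(d < r) f (lift w d) * s ^ d)%N.
Proof.
rewrite big_mkcond (bigD1_ord w) //= eqxx add0n; apply: eq_bigr => d _.
rewrite eq_sym neq_lift /dexp /= /bump; case: (leqP w d) => wd /=.
  by rewrite add1n ltnNge (leq_trans wd (leqnSn _)).
by rewrite add0n wd.
Qed.

(* Modulo s the exponent gives i w; its quotient lists the other i v as base s digits. *)
Lemma shift_exp_inj w c : injective (shift_exp w c).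
Proof.
move=> i j; rewrite /shift_exp => e.
have mods x y : (x < s)%N -> ((x + s * y) %% s = x)%N.
  by move=> xs; rewrite addnC mulnC modnMDl modn_small.
have ew : i w = j w :> nat.
  by have := congr1 (fun x => x %% s)%N e; rewrite !mods // box_lt.
move/eqP: e; rewrite ew eqn_add2l eqn_pmul2l // eqn_modDl !sum_dexp => /eqP.
have b1 := base_digits_bound (fun d => box_lt i (lift w d)).
have b2 := base_digits_bound (fun d => box_lt j (lift w d)).
rewrite !modn_small // => /(base_digits_inj (fun d => box_lt i _) (fun d => box_lt j _)) h.
apply/ffunP => v; apply: val_inj; case: (unliftP w v) => [d ->|->]; last exact: ew.
exact: h.
Qed.

Lemma shift_exp_lt w c i : (shift_exp w c i < s ^ r.+1)%N.
Proof.
rewrite /shift_exp; have := box_lt i w.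
have : (((c + \sum_(v < r.+1 | v != w) i v * s ^ dexp v w) %% s ^ r) < s ^ r)%N.
  by rewrite ltn_mod expn_gt0 s_gt0.
rewrite expnS; set x := (_ %% _)%N; set y := (s ^ r)%N => xy iw.
have : (s * x.+1 <= s * y)%N by rewrite leq_mul2l xy orbT.
by rewrite mulnS; lia.
Qed.

(** At beta_w this is the combination, with coefficients H, of the powers of beta_w that occur in
    the digits at all shifts of n, once the common factor beta_w^(k n_w) is taken out. *)
Definition freq_poly H w c : {poly F} :=
  \sum_i \sum_(j < k) (H i j : nat)%:R *: 'X^(k * shift_exp w c i + j).

Lemma size_freq_poly H w c : (size (freq_poly H w c) <= k * s ^ r.+1)%N.
Proof.
apply: (leq_trans (size_sum _ _ _)); apply/bigmax_leqP => i _.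
apply: (leq_trans (size_sum _ _ _)); apply/bigmax_leqP => j _.
apply: (leq_trans (size_scale_leq _ _)); rewrite size_polyXn.
have := shift_exp_lt w c i; have := ltn_ord j.
move: (shift_exp _ _ _) (s ^ r.+1)%N => x y jk xy.
have : (k * x.+1 <= k * y)%N by rewrite leq_mul2l xy orbT.
by rewrite mulnS; lia.
Qed.

(** Division by k with remainder j < k, together with [shift_exp_inj], separates the exponents, so
    every H i j is itself a coefficient; being below p, it vanishes in F only if it is zero. *)
Lemma freq_poly_neq0 H w c : H != 0 -> freq_poly H w c != 0.
Proof.
move=> H0; have [i0 [j0 hij]] : exists i, exists j, H i j != 0.
  case: (boolP [exists i, [exists j, H i j != 0]]) => [/existsP[i /existsP[j h]]|].
    by exists i, j.
  rewrite negb_exists => /forallP h; case/eqP: H0; apply/ffunP => i; apply/ffunP => j.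
  by have := h i; rewrite negb_exists => /forallP/(_ j); rewrite negbK !ffunE => /eqP.
apply/eqP => /(congr1 (fun P : {poly F} => P`_(k * shift_exp w c i0 + j0))).
rewrite coef0 coef_sum (bigD1 i0) //= coef_sum (bigD1 j0) //= coefZ coefXn eqxx mulr1.
have expE i (j : 'I_k) : (k * shift_exp w c i0 + j0 == k * shift_exp w c i + j)%N = (i0 == i) && (j0 == j).
  apply/eqP/andP => [e|[/eqP -> /eqP -> //]].
  have := congr1 (fun x => x %/ k)%N e.
  rewrite ![(k * _)%N]mulnC !divnMDl // !divn_small // !addn0 => /shift_exp_inj ei.
  by move: e; rewrite ei => /addnI/val_inj ->.
rewrite big1 ?addr0 => [|j jj]; last first.
  by rewrite coefZ coefXn expE [j0 == j]eq_sym (negPf jj) andbF mulr0.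
rewrite big1 ?addr0 => [|i ii]; last first.
  rewrite coef_sum big1 // => j _.
  by rewrite coefZ coefXn expE [i0 == i]eq_sym (negPf ii) mulr0.
move/eqP; rewrite -(dvdn_pcharf chF) => /dvdnP[m hm]; case/eqP: hij.
by rewrite -[H i0 j0]natr_Zp hm natrM pchar_Fp_0 // mulr0.
Qed.

Definition bracket H w (c : nat) (b : F) (x : nat) : F := b ^+ (k * x) * (freq_poly H w c).[b].

(* Quantifying over the residues c, c' replaces the condition on the pair (n, n'), which
   involves all coordinates through ntilde, by one on the w-th coordinates alone. *)
Definition collide H w (x y : nat) (b : F) : bool :=
  [exists c : 'I_(s ^ r), exists c' : 'I_(s ^ r), bracket H w c b x == bracket H w c' b y].

Lemma ntilde_lt n w : (ntilde s n w < s ^ r)%N.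
Proof. by rewrite ltn_mod expn_gt0 s_gt0. Qed.

Lemma trace_sum H alpha beta n :
  \sum_i \sum_(j < k) H i j * trace_digit alpha beta (fun v => n v + i v)%N j =
  \sum_w absTr chF (alpha w * bracket H w (ntilde s n w) (beta w) (n w)).
Proof.
have tr_sum (I : finType) (f : I -> F) : absTr chF (\sum_i f i) = \sum_i absTr chF (f i).
  by apply: (big_morph _ (@absTrD _ _ chF)); exact: (absTrMn chF 0 0).
transitivity (\sum_i \sum_(j < k) \sum_w absTr chF (alpha w * (beta w ^+ (k * n w) *
    ((H i j : nat)%:R * beta w ^+ (k * shift_exp w (ntilde s n w) i + j))))).
  apply: eq_bigr => i _; apply: eq_bigr => j _; rewrite /trace_digit mulr_sumr.
  apply: eq_bigr => w _; rewrite ntilde_shift -{1}[H i j]natr_Zp mulr_natl -absTrMn.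
  congr (absTr _ _); rewrite mulnDr -addnA exprD -mulr_natl; ring.
transitivity (\sum_w \sum_i \sum_(j < k) absTr chF (alpha w * (beta w ^+ (k * n w) *
    ((H i j : nat)%:R * beta w ^+ (k * shift_exp w (ntilde s n w) i + j))))).
  rewrite [RHS]exchange_big /=; apply: eq_bigr => i _; exact: exchange_big.
apply: eq_bigr => w _; rewrite /bracket /freq_poly horner_sum !mulr_sumr tr_sum.
apply: eq_bigr => i _; rewrite horner_sum !mulr_sumr tr_sum.
by apply: eq_bigr => j _; rewrite hornerZ hornerXn.
Qed.

Variables (R : realType) (zeta : complex R).
Hypotheses (zetaX : zeta ^+ p = 1) (zeta1 : zeta != 1).

Import Normc.

Definition net_psi H alpha beta n : complex R :=
  multi_psi zeta H (fun i => trace_digit alpha beta (fun v => n v + i v)%N).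

Lemma net_psiE H alpha beta n : net_psi H alpha beta n =
  \prod_w chi zeta (absTr chF (alpha w * bracket H w (ntilde s n w) (beta w) (n w))).
Proof.
rewrite -(chi_sum p_pr zetaX) -trace_sum (chi_sum p_pr zetaX).
by apply: eq_bigr => i _; rewrite /psi (chi_sum p_pr zetaX).
Qed.

Lemma trace_orthogonality (u : F) :
  \sum_a chi zeta (absTr chF (a * u)) = if u == 0 then q%:R else 0.
Proof.
case: eqVneq => [->|u0].
  rewrite (eq_bigr (fun=> 1)); last first.
    by move=> a _; rewrite mulr0 (absTrMn chF 0 0) chi0.
  by rewrite sumr_const card_F.
have [x x0] := absTr_nontrivial chF.
apply: (@character_sum0 _ _ (fun a => chi zeta (absTr chF (a * u))) (x / u)).
  by move=> a b; rewrite mulrDl absTrD (chiD p_pr zetaX).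
by rewrite divfK // (chi_neq1 p_pr zetaX zeta1).
Qed.

Definition box_sum (B : nat) (A : 'I_r.+1 -> pred 'I_B) H alpha beta : complex R :=
  \sum_(n : {ffun 'I_r.+1 -> 'I_B} | n \in family A) net_psi H alpha beta (fun w => n w).

Lemma alpha_moment (B : nat) (A : 'I_r.+1 -> pred 'I_B) H beta :
  \sum_(alpha : {ffun 'I_r.+1 -> F}) normc (box_sum A H alpha beta) ^+ 2 <=
  (q ^ r.+1 * \sum_(n : {ffun 'I_r.+1 -> 'I_B} | n \in family A)
     \sum_(n' : {ffun 'I_r.+1 -> 'I_B} | n' \in family A)
       \prod_w collide H w (n w) (n' w) (beta w))%N%:R.
Proof.
pose D w (n n' : {ffun 'I_r.+1 -> 'I_B}) : F :=
  bracket H w (ntilde s (fun w => n w) w) (beta w) (n w)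
  - bracket H w (ntilde s (fun w => n' w) w) (beta w) (n' w).
have absTrN x : absTr chF (- x) = - absTr chF x.
  by apply: (addrI (absTr chF x)); rewrite -absTrD !subrr (absTrMn chF 0 0).
have E : (\sum_(alpha : {ffun 'I_r.+1 -> F}) normc (box_sum A H alpha beta) ^+ 2)%:C%C =
  \sum_(n in family A) \sum_(n' in family A) \prod_w (if D w n n' == 0 then q%:R else 0).
  rewrite (rmorph_sum (real_complex R)).
  transitivity (\sum_(alpha : {ffun 'I_r.+1 -> F}) \sum_(n in family A) \sum_(n' in family A)
     \prod_w chi zeta (absTr chF (alpha w * D w n n'))).
    apply: eq_bigr => alpha _; rewrite [LHS]sqr_normcE conjc_sum mulr_suml.
    apply: eq_bigr => n _; rewrite mulr_sumr; apply: eq_bigr => n' _.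
    rewrite !net_psiE (big_morph _ (@conjcM R) (conjc1 R)) -big_split /=.
    apply: eq_bigr => w _; rewrite (conjc_chi p_pr zetaX) -(chiD p_pr zetaX) /D.
    by rewrite -absTrN -absTrD mulrBr.
  rewrite exchange_big; apply: eq_bigr => n _; rewrite exchange_big.
  apply: eq_bigr => n' _.
  under [RHS]eq_bigr => w _ do rewrite -trace_orthogonality.
  by rewrite bigA_distr_bigA.
rewrite -lecR E (rmorph_nat (real_complex R)) natrM natr_sum mulr_sumr.
apply: ler_sum => n _; rewrite natr_sum mulr_sumr; apply: ler_sum => n' _.
case: (boolP [forall w, D w n n' == 0]) => [/forallP h|].
  rewrite (eq_bigr (fun=> q%:R)) => [|w _]; last by rewrite h.
  rewrite prodr_const card_ord -natrX big1 ?mulr1 // => w _.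
  have hc : collide H w (n w) (n' w) (beta w).
    apply/existsP; exists (Ordinal (ntilde_lt (fun w => n w) w)).
    apply/existsP; exists (Ordinal (ntilde_lt (fun w => n' w) w)).
    by rewrite /= -subr_eq0; exact: h.
  by rewrite hc.
rewrite negb_forall => /existsP[w hw].
by rewrite (bigD1 w) //= (negPf hw) mul0r mulr_ge0.
Qed.

Definition primitive_set : {set F} := [set b | (q - 1).-primitive_root b].

Local Notation phi := (totient (q - 1)).

Lemma card_primitive_set : (1 < q)%N -> #|primitive_set| = phi.
Proof.
move=> q1; apply: card_primitive_roots; last by rewrite subn_gt0.
by rewrite card_F subn1 prednK // ltnW.
Qed.

Lemma count_power_solutions (B a l : nat) (A : pred 'I_B) (b t u : F) :
  (1 < q)%N -> b \in primitive_set -> t != 0 -> (forall x, A x -> (a <= x < a + l)%N) ->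
  (#|[set x | A x & (b ^+ (k * x)%N * t == u)%R]| <= (k * l) %/ (q - 1) + 1)%N.
Proof.
move=> q1; rewrite inE => bP t0 hA.
apply: (@card_congr_multiples _ a) => //; first by lia.
  by move=> x; rewrite inE => /andP[/hA].
move=> x y; rewrite !inE => /andP[_ /eqP ex] /andP[_ /eqP ey].
apply/eqP; rewrite -(eq_prim_root_expr bP); apply/eqP.
by apply: (mulIf t0); rewrite ex ey.
Qed.

(* Primitivity of b makes the x with b ^ (k x) prescribed rare, unless b is one of the
   few roots of some frequency polynomial. *)
Lemma collision_count (B a l : nat) (A : pred 'I_B) H w :
  (1 < q)%N -> H != 0 -> (forall x, A x -> (a <= x < a + l)%N) -> (#|A| <= l)%N ->
  (\sum_(b in primitive_set) \sum_(x | A x) \sum_(y | A y) collide H w x y b <=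
   s ^ (2 * r.+1) * (l * (phi + 2 * k * l)))%N.
Proof.
move=> q1 H0 hA cA; pose K := (s ^ r)%N.
pose bad := [set b in primitive_set | [exists c : 'I_K, root (freq_poly H w c) b]].
have badle : (#|bad| <= K * (k * s ^ r.+1))%N.
  apply: (@leq_trans (\sum_(c < K) #|[set b | root (freq_poly H w c) b]|)%N).
    rewrite -sum1_card (@leq_trans (\sum_(b in bad) \sum_(c < K) root (freq_poly H w c) b)%N) //.
      apply: leq_sum => b; rewrite inE => /andP[_ /existsP[c hc]].
      by rewrite (bigD1 c) //= hc.
    rewrite exchange_big; apply: leq_sum => c _.
    rewrite -sum1_card big_mkcond [X in (_ <= X)%N]big_mkcond /=; apply: leq_sum => b _.
    by rewrite [in X in (_ <= X)%N]inE; case: ifP; case: root.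
  rewrite -[K in (_ <= K * _)%N]card_ord -sum_nat_const; apply: leq_sum => c _.
  rewrite cardE; apply: leq_trans (size_freq_poly H w c); apply: ltnW.
  apply: max_poly_roots; rewrite ?freq_poly_neq0 ?enum_uniq //.
  by apply/allP => b; rewrite mem_enum inE.
have good_count b : b \in primitive_set -> b \notin bad ->
  (\sum_(x | A x) \sum_(y | A y) collide H w x y b <= K * K * (l * ((k * l) %/ (q - 1) + 1)))%N.
  move=> bP; rewrite inE bP /= negb_exists => /forallP nb.
  rewrite exchange_big /=.
  have inner y : (\sum_(x | A x) collide H w x y b <= K * K * ((k * l) %/ (q - 1) + 1))%N.
    apply: (@leq_trans (\sum_(x | A x) \sum_(c < K) \sum_(c' < K)
        (bracket H w c b x == bracket H w c' b y))%N).
      apply: leq_sum => x _; rewrite /collide.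
      case: existsP => //= -[c /existsP[c' h]].
      by rewrite (bigD1 c) //= (bigD1 c') //= h.
    rewrite exchange_big -mulnA -[K in (_ <= K * _)%N]card_ord -sum_nat_const.
    apply: leq_sum => c _.
    rewrite exchange_big -[K in (_ <= K * _)%N]card_ord -sum_nat_const.
    apply: leq_sum => c' _.
    apply: leq_trans (count_power_solutions (bracket H w c' b y) q1 bP (nb c) hA).
    rewrite -sum1_card big_mkcond [X in (_ <= X)%N]big_mkcond /=; apply: leq_sum => x _.
    by rewrite inE /bracket; case: (A x) => //=; case: eqP.
  apply: (@leq_trans (\sum_(y | A y) K * K * ((k * l) %/ (q - 1) + 1))%N).
    by apply: leq_sum => y _; exact: inner.
  by rewrite sum_nat_const mulnCA leq_mul2l leq_mul2r cA !orbT.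
(* At a root of a frequency polynomial all pairs may collide. The degree bounds the number of such
   b, and they account for one of the two terms k l in the result. *)
have trivial_count b : (\sum_(x | A x) \sum_(y | A y) collide H w x y b <= l * l)%N.
  apply: (@leq_trans (\sum_(x | A x) \sum_(y | A y) 1)%N).
    by apply: leq_sum => x _; apply: leq_sum => y _; exact: leq_b1.
  by rewrite sum1_card sum_nat_const leq_mul.
rewrite (bigID (mem bad)) /=.
have h1 : (\sum_(b in primitive_set | b \in bad)
    \sum_(x | A x) \sum_(y | A y) collide H w x y b <= K * (k * s ^ r.+1) * (l * l))%N.
  apply: (@leq_trans (\sum_(b in primitive_set | b \in bad) l * l)%N).
    by apply: leq_sum => b _; exact: trivial_count.
  rewrite sum_nat_const leq_mul2r; apply/orP; right; apply: leq_trans badle.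
  by apply: subset_leq_card; apply/fintype.subsetP => b; rewrite unfold_in => /andP[].
have h2 : (\sum_(b in primitive_set | b \notin bad)
    \sum_(x | A x) \sum_(y | A y) collide H w x y b <=
    phi * (K * K * (l * ((k * l) %/ (q - 1) + 1))))%N.
  apply: (@leq_trans (\sum_(b in primitive_set | b \notin bad)
      K * K * (l * ((k * l) %/ (q - 1) + 1)))%N).
    by apply: leq_sum => b /andP[bP bbad]; exact: good_count.
  rewrite sum_nat_const leq_mul2r; apply/orP; right; rewrite -card_primitive_set //.
  by apply: subset_leq_card; apply/fintype.subsetP => b; rewrite unfold_in => /andP[].
apply: (leq_trans (leq_add h1 h2)).
(* As phi <= q - 1 the modulus cancels: over all good b there are at most k l + phi solutions x for
   given y and residues. *)
have hphi : (phi * ((k * l) %/ (q - 1)) <= k * l)%N.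
  by apply: leq_trans (leq_trunc_div (k * l) (q - 1)); rewrite mulnC leq_mul2l totient_le orbT.
have hs : (s ^ (2 * r.+1) = K * K * (s * s))%N by rewrite mul2n -addnn !expnD !expnS /K; ring.
have -> : (phi * (K * K * (l * ((k * l) %/ (q - 1) + 1))) =
    K * K * (l * (phi * ((k * l) %/ (q - 1)) + phi)))%N by ring.
have -> : (K * (k * s ^ r.+1) * (l * l) = K * K * (s * (k * l * l)))%N by rewrite expnS /K; ring.
rewrite hs -mulnDr -[X in (_ <= X)%N]mulnA leq_mul2l; apply/orP; right.
move: hphi; set y := (phi * _)%N => hy; set f := phi.
apply: (@leq_trans (s * (k * l * l) + l * (k * l + f))%N).
  by rewrite leq_add2l leq_mul2l leq_add2r hy orbT.
have ss : (s <= s * s)%N by rewrite -{1}[s]muln1 leq_mul2l s_gt0 orbT.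
have s1 : (1 <= s * s)%N by rewrite muln_gt0 s_gt0.
have -> : (s * s * (l * (f + 2 * k * l)) = s * s * (k * l * l) + s * s * (l * (k * l + f)))%N by ring.
by apply: leq_add; [rewrite leq_mul2r ss orbT | rewrite -{1}[(l * _)%N]mul1n leq_mul2r s1 orbT].
Qed.

(** Since [collide H w] involves only the w-th coordinates of n, n' and beta, the triple sum is the
    product of the one-dimensional counts. *)
Lemma second_moment (B : nat) (a l : 'I_r.+1 -> nat) (A : 'I_r.+1 -> pred 'I_B) H :
  (1 < q)%N -> H != 0 -> (forall w x, A w x -> (a w <= x < a w + l w)%N) ->
  (forall w, (#|A w| <= l w)%N) ->
  \sum_(beta : {ffun 'I_r.+1 -> F} | beta \in family (fun=> mem primitive_set))
     \sum_(alpha : {ffun 'I_r.+1 -> F}) normc (box_sum A H alpha beta) ^+ 2 <=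
  (q ^ r.+1 * \prod_w (s ^ (2 * r.+1) * (l w * (phi + 2 * k * l w))))%N%:R.
Proof.
move=> q1 H0 hA cA.
apply: (le_trans (ler_sum _ (fun beta _ => alpha_moment A H beta))).
rewrite -natr_sum ler_nat -big_distrr leq_mul2l; apply/orP; right => /=.
apply: (@leq_trans (\prod_w \sum_(b in primitive_set) \sum_(x | A w x) \sum_(y | A w y)
    collide H w x y b)%N); last first.
  by apply: leq_prod => w _; exact: (collision_count w q1 H0 (hA w) (cA w)).
rewrite bigA_distr_big_dep /=; apply: leq_sum => beta _.
rewrite bigA_distr_big_dep /=; apply: leq_sum => n _.
by rewrite bigA_distr_big_dep /=.
Qed.

End ExponentialSums.

(** * Maximal inequality *)

(** Cauchy-Schwarz with weights, from 2 a_i a_j <= a_i^2 + a_j^2 in the double sum. *)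
Lemma sqr_sum_weighted (R : realType) (I : finType) (P : pred I) (w a : I -> R) :
  (forall i, 0 <= w i) ->
  (\sum_(i | P i) w i * a i) ^+ 2 <= (\sum_(i | P i) w i) * \sum_(i | P i) w i * a i ^+ 2.
Proof.
move=> w0; set W := \sum_(i | P i) w i; set Q := \sum_(i | P i) w i * a i ^+ 2.
have e : W * Q = \sum_(i | P i) \sum_(j | P j) w i * w j * ((a i ^+ 2 + a j ^+ 2) / 2).
  transitivity ((W * Q + Q * W) / 2); first by field.
  rewrite {1 2}/W !mulr_suml -big_split /= mulr_suml; apply: eq_bigr => i _.
  by rewrite !mulr_sumr -big_split /= mulr_suml; apply: eq_bigr => j _; field.
rewrite e expr2 mulr_suml; apply: ler_sum => i _; rewrite mulr_sumr; apply: ler_sum => j _.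
rewrite mulrACA ler_wpM2l ?mulr_ge0 // ler_pdivlMr //.
by rewrite -subr_ge0 (_ : _ - _ = (a i - a j) ^+ 2) ?sqr_ge0 //; ring.
Qed.

Lemma card_interval (B a l : nat) (A : pred 'I_B) :
  (forall x, A x -> (a <= x < a + l)%N) -> (#|A| <= l)%N.
Proof.
move=> hA; case: l hA => [|l] hA.
  by rewrite leqn0; apply/eqP/eq_card0 => x; apply/negP => /hA; lia.
pose f (x : 'I_B) : 'I_l.+1 := inord (x - a).
rewrite -[X in (_ <= X)%N]card_ord -(card_in_imset (f := f)) ?max_card // => x y xA yA.
move/(congr1 val); have := hA x xA; have := hA y yA; rewrite /f /= => h1 h2.
by rewrite !inordK => [e||]; try lia; apply: val_inj => /=; lia.
Qed.

Section RademacherMenshov.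

Variables (R : realType) (I : finType) (B D : nat) (m : I -> nat).
Hypothesis m_le : forall w, (2 ^ m w <= D)%N.

Import Normc.

Definition dyadic_block (j a : nat) : pred 'I_B := fun x => (x %/ 2 ^ j)%N == a.

Definition maximal_majorant (g : {ffun I -> 'I_B} -> R[i]) : R :=
  (\prod_w m w)%N%:R *
  \sum_(J : {ffun I -> 'I_D} | J \in family (fun w => [pred j : 'I_D | (j < m w)%N]))
  \sum_(a : {ffun I -> 'I_D} | a \in family (fun w => [pred x : 'I_D | (x < 2 ^ (m w - J w))%N]))
    normc (\sum_(n : {ffun I -> 'I_B} | n \in family (fun w => dyadic_block (J w) (a w))) g n) ^+ 2.

Lemma family_indicator (V : comNzRingType) (J : finType) (Q : I -> pred J) (f : {ffun I -> J}) :
  (f \in family Q)%:R = \prod_w (Q w (f w))%:R :> V.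
Proof.
case: familyP => [h|h]; first by rewrite big1 // => w _; rewrite [Q w _](h w).
have [w hw] : exists w, ~~ Q w (f w).
  apply/existsP; rewrite -negb_forall; apply/negP => /forallP h'; apply: h => w; exact: h'.
by rewrite (bigD1 w) //= (negPf hw) mul0r.
Qed.

(** The product over w of the splittings of [0, N w) has at most one block for each J. After
    Cauchy-Schwarz over J, that block is dominated by the sum over all blocks with the same
    scales. *)
Lemma rademacher_menshov (g : {ffun I -> 'I_B} -> R[i]) (N : I -> nat) :
  (forall w, (N w < 2 ^ m w)%N) ->
  normc (\sum_(n : {ffun I -> 'I_B} | n \in family (fun w => [pred x : 'I_B | (x < N w)%N])) g n) ^+ 2
  <= maximal_majorant g.
Proof.
move=> hN.
pose piece (J : {ffun I -> 'I_D}) w : pred 'I_B :=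
  fun x => odd (N w %/ 2 ^ J w) && ((x %/ 2 ^ J w).+1 == N w %/ 2 ^ J w)%N.
pose FJ := [pred J : {ffun I -> 'I_D} | J \in family (fun w => [pred j : 'I_D | (j < m w)%N])].
have mD w : (m w <= D)%N by apply: leq_trans (m_le w); exact/ltnW/ltn_expl.
have ind (n : {ffun I -> 'I_B}) :
  (n \in family (fun w => [pred x : 'I_B | (x < N w)%N]))%:R
  = \sum_(J | FJ J) (n \in family (piece J))%:R :> R[i].
  rewrite family_indicator (eq_bigr (fun w => \sum_(j < D | (j < m w)%N)
     ((odd (N w %/ 2 ^ j) && ((n w %/ 2 ^ j).+1 == N w %/ 2 ^ j)%N) : bool)%:R)); last first.
    move=> w _; rewrite /= (dyadic_split (n w) (hN w)) natr_sum.
    by rewrite (big_ord_widen _ (fun j => (odd (N w %/ 2 ^ j) && ((n w %/ 2 ^ j).+1 == N w %/ 2 ^ j)%N)%:R) (mD w)).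
  rewrite bigA_distr_big_dep; apply: eq_bigr => J _.
  by rewrite family_indicator.
have -> : \sum_(n : {ffun I -> 'I_B} | n \in family (fun w => [pred x : 'I_B | (x < N w)%N])) g n
   = \sum_(J | FJ J) \sum_(n : {ffun I -> 'I_B} | n \in family (piece J)) g n.
  rewrite big_mkcond; transitivity (\sum_n \sum_(J | FJ J) (n \in family (piece J))%:R * g n).
    by apply: eq_bigr => n _; rewrite -mulr_suml -ind; case: ifP => _; rewrite ?mul1r ?mul0r.
  rewrite exchange_big; apply: eq_bigr => J _; rewrite [RHS]big_mkcond; apply: eq_bigr => n _ /=.
  by case: ifP => _; rewrite ?mul1r ?mul0r.
pose G J := normc (\sum_(n : {ffun I -> 'I_B} | n \in family (piece J)) g n).
have cJ : \sum_(J | FJ J) 1 = (\prod_w m w)%N%:R :> R.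
  transitivity ((\sum_(J | FJ J) 1)%N%:R : R); first by rewrite natr_sum.
  rewrite sum1_card; congr (_%:R).
  rewrite (_ : #|_| = #|family (fun w => [pred j : 'I_D | (j < m w)%N])|); last by apply: eq_card.
  rewrite card_family foldrE big_map big_enum; apply: eq_bigr => w _.
  by rewrite -sum1_card -(big_ord_widen _ (fun=> 1%N) (mD w)) sum1_card card_ord.
have h : (\sum_(J | FJ J) G J) ^+ 2 <= (\prod_w m w)%N%:R * \sum_(J | FJ J) G J ^+ 2.
  have /= := sqr_sum_weighted FJ G (fun=> ler01).
  rewrite cJ (eq_bigr G (fun J _ => mul1r (G J))).
  by rewrite (eq_bigr (fun J => G J ^+ 2) (fun J _ => mul1r (G J ^+ 2))).
apply: (@le_trans _ _ ((\sum_(J | FJ J) G J) ^+ 2)).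
  by rewrite lerXn2r ?nnegrE ?normc_ge0 ?sumr_ge0 ?normc_sum // => *; exact: normc_ge0.
apply: (le_trans h); rewrite /maximal_majorant ler_wpM2l //.
apply: ler_sum => J hJ; rewrite /G.
case: (boolP [forall w, odd (N w %/ 2 ^ J w)]) => [/forallP od|]; last first.
  rewrite negb_forall => /existsP[w hw].
  rewrite big_pred0 ?normc0 ?expr0n ?sumr_ge0 // => [a _|n]; first by rewrite exprn_ge0 ?normc_ge0.
  by apply/negP => /familyP/(_ w); rewrite unfold_in /piece (negPf hw).
have alt w : ((N w %/ 2 ^ J w).-1 < 2 ^ (m w - J w))%N.
  have /familyP/(_ w) := hJ; rewrite inE => jm.
  have : (N w %/ 2 ^ J w < 2 ^ (m w - J w))%N.
    by rewrite ltn_divLR ?expn_gt0 // -expnD subnK // ltnW.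
  lia.
have aD w : ((N w %/ 2 ^ J w).-1 < D)%N.
  apply: leq_trans (alt w) (leq_trans _ (m_le w)); rewrite leq_exp2l //; exact: leq_subr.
(* The position of the block is one less than N w / 2^(J w), a genuine predecessor because this
   quotient is odd. *)
pose a : {ffun I -> 'I_D} := [ffun w => Ordinal (aD w)].
rewrite (bigD1 a) /=; last by apply/familyP => w; rewrite inE ffunE /=.
rewrite (_ : \sum_(n : {ffun I -> 'I_B} | n \in family (piece J)) g n =
   \sum_(n : {ffun I -> 'I_B} | n \in family (fun w => dyadic_block (J w) (a w))) g n).
  by rewrite lerDl sumr_ge0 // => ? _; rewrite exprn_ge0 ?normc_ge0.
apply: eq_bigl => n; apply/familyP/familyP => h' w; have := h' w; have := od w;
  rewrite !unfold_in /piece /dyadic_block ffunE /= => ow.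
  by move=> /andP[_ /eqP <-].
by move=> /eqP ->; rewrite ow /= prednK //; case: (N w %/ _)%N ow.
Qed.

End RademacherMenshov.

(** The sum of j^(-3/2), bounded as by the integral through the telescoping 3 - 2 / sqrt n. It is
    what one coordinate contributes when the means of all scales are added. *)
Lemma sum_inv_sqrt_cube (R : realType) (n : nat) :
  \sum_(j < n) (j.+1%:R * Num.sqrt j.+1%:R)^-1 <= 3 :> R.
Proof.
suff : \sum_(j < n.+1) (j.+1%:R * Num.sqrt j.+1%:R)^-1 <= 3 - 2 / Num.sqrt n.+1%:R :> R.
  rewrite big_ord_recr /=; set x := (_ * _)^-1; set y := 2 / _ => h.
  have : 0 <= x by rewrite invr_ge0 mulr_ge0 ?sqrtr_ge0.
  have : 0 <= y by rewrite divr_ge0 ?sqrtr_ge0.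
  by move: h; move: (\sum_(_ < _) _) x y => u x y; lra.
elim: n => [|n IH]; first by rewrite big_ord_recl big_ord0 /= !sqrtr1 mulr1 !invr1; lra.
rewrite big_ord_recr /=; move: IH; set t := \sum_(_ < _) _ => IH.
set a := Num.sqrt n.+1%:R in IH; set b := Num.sqrt n.+2%:R.
have a0 : 0 < a by rewrite sqrtr_gt0 ltr0n.
have b0 : 0 < b by rewrite sqrtr_gt0 ltr0n.
have b2 : n.+2%:R = b ^+ 2 by rewrite sqr_sqrtr.
have a2 : a ^+ 2 + 1 = b ^+ 2 by rewrite !sqr_sqrtr // natr1.
have ab : a <= b by rewrite ler_wsqrtr // ler_nat.
suff h : (n.+2%:R * b)^-1 <= 2 / a - 2 / b.
  by apply: (le_trans (lerD IH h)); lra.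
rewrite b2 -[X in _ <= X](_ : 2 / (a * b * (a + b)) = _); last first.
  have -> : 2 / a - 2 / b = 2 * (b - a) / (a * b) by field; rewrite !gt_eqF.
  have e : (b - a) * (a + b) = 1 by rewrite (_ : _ * _ = b ^+ 2 - a ^+ 2); [rewrite -a2; ring | ring].
  have -> : b - a = (a + b)^-1.
    by apply: (mulIf (x := a + b)); rewrite ?e ?mulVf // gt_eqF // addr_gt0.
  by rewrite !invfM; ring.
rewrite ler_pdivlMr ?mulr_gt0 ?addr_gt0 // mulrC ler_pdivrMr ?mulr_gt0 ?exprn_gt0 //.
by rewrite -exprSr; nra.
Qed.

(** * Averages over the parameters at one dyadic scale *)

Section ScaleMoment.

Variables (p k r s : nat) (F : finFieldType) (chF : p \in [pchar F]).
Variables (S : {ffun 'I_r.+1 -> nat}).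
Hypotheses (p_pr : prime p) (k_gt0 : (0 < k)%N) (s_gt0 : (0 < s)%N).
Hypothesis S_le : forall w, (S w <= s)%N.
Hypothesis card_F : #|F| = (p ^ k)%N.
Variables (R : realType) (zeta : complex R).
Hypotheses (zetaX : zeta ^+ p = 1) (zeta1 : zeta != 1).
Local Notation q := (p ^ k)%N.
Local Notation phi := (totient (q - 1)).
Hypothesis q_gt1 : (1 < q)%N.
Variables (B D : nat) (m : 'I_r.+1 -> nat).
Hypothesis m_D : forall w, (2 ^ m w <= D)%N.

Local Notation Box := {dffun forall w : 'I_r.+1, 'I_(S w)}.
Local Notation Primitive := (family (fun=> mem (primitive_set p k F))).

Definition net_majorant (H : {ffun Box -> {ffun 'I_k -> 'F_p}}) alpha beta : R :=
  maximal_majorant D m (fun n : {ffun 'I_r.+1 -> 'I_B} =>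
    net_psi s chF zeta H alpha beta (fun w => n w)).

(** At scale j there are 2^(m - j) blocks of length 2^j, so each scale contributes 2^m (phi + 2 k
    2^j), largest at j = m. The m scales and the factor m of the majorant give m^2. *)
Lemma majorant_moment H : H != 0 ->
  \sum_(beta : {ffun 'I_r.+1 -> F} | beta \in Primitive)
     \sum_(alpha : {ffun 'I_r.+1 -> F}) net_majorant H alpha beta <=
  (q ^ r.+1 * \prod_w (m w ^ 2 * 2 ^ m w * (s ^ (2 * r.+1) * (phi + 2 * k * 2 ^ m w))))%N%:R.
Proof.
move=> H0.
pose FJ := [pred J : {ffun 'I_r.+1 -> 'I_D} | J \in family (fun w => [pred j : 'I_D | (j < m w)%N])].
pose Fa (J : {ffun 'I_r.+1 -> 'I_D}) := [pred a : {ffun 'I_r.+1 -> 'I_D} |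
  a \in family (fun w => [pred x : 'I_D | (x < 2 ^ (m w - J w))%N])].
pose X (J a : {ffun 'I_r.+1 -> 'I_D}) alpha beta := Normc.normc (box_sum s chF zeta
  (fun w => @dyadic_block B (J w) (a w)) H alpha beta) ^+ 2.
have -> : \sum_(beta : {ffun 'I_r.+1 -> F} | beta \in Primitive)
     \sum_(alpha : {ffun 'I_r.+1 -> F}) net_majorant H alpha beta =
  (\prod_w m w)%N%:R * \sum_(J | FJ J) \sum_(a | Fa J a)
    \sum_(beta : {ffun 'I_r.+1 -> F} | beta \in Primitive)
      \sum_(alpha : {ffun 'I_r.+1 -> F}) X J a alpha beta.
  transitivity (\sum_(beta : {ffun 'I_r.+1 -> F} | beta \in Primitive)
    (\prod_w m w)%N%:R * \sum_(J | FJ J) \sum_(a | Fa J a)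
      \sum_(alpha : {ffun 'I_r.+1 -> F}) X J a alpha beta).
    apply: eq_bigr => beta _; rewrite -mulr_sumr; congr (_ * _).
    by rewrite exchange_big; apply: eq_bigr => J _; exact: exchange_big.
  rewrite -mulr_sumr; congr (_ * _).
  by rewrite exchange_big; apply: eq_bigr => J _; exact: exchange_big.
pose g j := (s ^ (2 * r.+1) * (2 ^ j * (phi + 2 * k * 2 ^ j)))%N.
have step : \sum_(J | FJ J) \sum_(a | Fa J a)
    \sum_(beta : {ffun 'I_r.+1 -> F} | beta \in Primitive)
      \sum_(alpha : {ffun 'I_r.+1 -> F}) X J a alpha beta <=
  (\sum_(J | FJ J) \sum_(a | Fa J a) q ^ r.+1 * \prod_w g (J w))%N%:R.
  rewrite natr_sum; apply: ler_sum => J _; rewrite natr_sum; apply: ler_sum => a _.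
  have hA w (x : 'I_B) : dyadic_block (J w) (a w) x ->
      (a w * 2 ^ J w <= x < a w * 2 ^ J w + 2 ^ J w)%N.
    rewrite /dyadic_block => /eqP <-; rewrite leq_trunc_div /=.
    by rewrite addnC -mulSn; apply: ltn_ceil; rewrite expn_gt0.
  exact: (second_moment chF p_pr k_gt0 s_gt0 S_le card_F zetaX zeta1 q_gt1 H0 hA
    (fun w => card_interval (hA w))).
apply: (le_trans (ler_wpM2l (ler0n _ _) step)); rewrite -natrM ler_nat.
rewrite (eq_bigr (fun J : {ffun 'I_r.+1 -> 'I_D} =>
    q ^ r.+1 * \sum_(a | Fa J a) \prod_w g (J w))%N); last first.
  by move=> J _; rewrite -big_distrr.
rewrite -big_distrr /= mulnCA leq_mul2l; apply/orP; right.
have e : (\sum_(J | FJ J) \sum_(a | Fa J a) \prod_w g (J w) =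
   \prod_w \sum_(j < D | (j < m w)%N) \sum_(x < D | (x < 2 ^ (m w - j))%N) g j)%N.
  rewrite bigA_distr_big_dep; apply: eq_bigr => J _ /=.
  by rewrite bigA_distr_big_dep.
rewrite e -big_split /=; apply: leq_prod => w _.
rewrite -mulnn -!mulnA leq_mul2l; apply/orP; right.
have mD : (m w <= D)%N by apply: leq_trans (m_D w); exact/ltnW/ltn_expl.
set c := (2 ^ m w * _)%N.
apply: (@leq_trans (\sum_(j < D | (j < m w)%N) c)%N); last first.
  by rewrite -(big_ord_widen _ (fun=> c) mD) sum_nat_const card_ord.
apply: leq_sum => j jm.
have jD : (2 ^ (m w - j) <= D)%N by apply: leq_trans (m_D w); rewrite leq_exp2l // leq_subr.
rewrite -(big_ord_widen _ (fun=> g j) jD) sum_nat_const card_ord /g /c.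
rewrite mulnCA [X in (_ <= X)%N]mulnCA leq_mul2l; apply/orP; right.
rewrite mulnA -expnD subnK; last exact: ltnW.
by rewrite -mulnA leq_mul2l leq_add2l !leq_mul2l leq_exp2l // (ltnW jm) !orbT.
Qed.

End ScaleMoment.

(** The box type depends on N; in the fixed function type N only restricts the range, as a majorant
    common to all N requires. *)
Lemma sum_dffun_box (V : nmodType) (I : finType) (B : nat) (N : I -> nat) (g : (I -> nat) -> V) :
  (forall w, (0 < N w)%N) -> (forall w, (N w <= B)%N) ->
  \sum_(t : {dffun forall w : I, 'I_(N w)}) g (fun w => t w : nat) =
  \sum_(n : {ffun I -> 'I_B} | n \in family (fun w => [pred x : 'I_B | (x < N w)%N]))
    g (fun w => n w : nat).
Proof.
move=> N0 NB.
pose h (t : {dffun forall w : I, 'I_(N w)}) : {ffun I -> 'I_B} := [ffun w => widen_ord (NB w) (t w)].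
pose h' (n : {ffun I -> 'I_B}) : {dffun forall w : I, 'I_(N w)} :=
  finfun (fun w => Ordinal (ltn_pmod (n w) (N0 w))).
rewrite (reindex_onto h h') /=; last first.
  move=> n /familyP hn; apply/ffunP => w; rewrite !ffunE; apply: val_inj => /=.
  by rewrite modn_small //; exact: hn.
apply: eq_big => [t|t _]; last by congr (g _); apply/funext => w; rewrite ffunE.
symmetry; apply/andP; split; first by apply/familyP => w; rewrite inE ffunE /=.
apply/eqP/ffunP => w; apply: val_inj; rewrite !ffunE /=.
by rewrite modn_small.
Qed.

Lemma card_dffun_ord (I : finType) (N : I -> nat) :
  #|{dffun forall w : I, 'I_(N w)}| = (\prod_w N w)%N.
Proof.
rewrite card_dep_ffun foldrE big_map big_enum.
by apply: eq_bigr => w _; rewrite card_ord.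
Qed.

(** The square root of [scale_totient_bound], with 193 = 1 + 2 * 96. *)
Lemma totient_scale_real (R : realType) (p k m : nat) :
  (1 < p)%N -> (0 < k)%N -> (1 < p ^ k)%N -> (2 ^ m <= 2 * p ^ k)%N -> (0 < m)%N ->
  (totient (p ^ k - 1) + 2 * k * 2 ^ m)%N%:R
   <= 193 * (totient (p ^ k - 1))%:R * (m%:R * Num.sqrt m%:R) :> R.
Proof.
move=> p1 k0 q1 mq m0; have := scale_totient_bound p1 k0 q1 mq m0.
set phi := totient _; set x := (k * 2 ^ m)%N => h.
set y := m%:R * Num.sqrt m%:R.
have m1 : 1 <= m%:R :> R by rewrite ler1n.
have sm1 : 1 <= Num.sqrt m%:R :> R by rewrite -[X in X <= _]sqrtr1 ler_wsqrtr.
have y1 : 1 <= y by rewrite mulr_ege1.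
have xle : x%:R <= 96 * y * phi%:R :> R.
  rewrite -(@ler_pXn2r _ 2) ?nnegrE ?mulr_ge0 ?sqrtr_ge0 //.
  rewrite !exprMn sqr_sqrtr // -exprSr -!natrX -!natrM ler_nat.
  by apply: (leq_trans h).
rewrite natrD -mulnA natrM -/x.
have hy : phi%:R <= phi%:R * y by rewrite ler_peMr.
move: xle hy; set u := phi%:R; set v := x%:R => xle hy; nra.
Qed.

Section ScaleDiscrepancy.

Variables (p k r s : nat) (F : finFieldType) (chF : p \in [pchar F]).
Variables (S : {ffun 'I_r.+1 -> nat}).
Hypotheses (p_pr : prime p) (k_gt0 : (0 < k)%N) (s_gt0 : (0 < s)%N).
Hypothesis S_le : forall w, (S w <= s)%N.
Hypothesis card_F : #|F| = (p ^ k)%N.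
Variable (R : realType).
Local Notation q := (p ^ k)%N.
Local Notation phi := (totient (q - 1)).
Hypothesis q_gt1 : (1 < q)%N.

Local Notation Primitive := (family (fun=> mem (primitive_set p k F))).
Local Notation tuple_F := {ffun 'I_r.+1 -> F}.

Import Normc.

Lemma xvec_digit_value alpha beta (n : 'I_r.+1 -> nat) :
  @xvec R p k r.+1 s F chF alpha beta S n =
  (fun i => digit_value R k (trace_digit k s chF alpha beta (fun v => n v + i v)%N)).
Proof.
apply/funext => i; rewrite /xvec /xpoint /digit_value; apply: eq_bigr => j _.
by rewrite trace_digitE.
Qed.

(** Z is the W-weighted sum of the majorants divided by its natural size [Wb * P]. Of the power m^5
    in P, m^2 is the maximal inequality and m^(3/2) the totient; the remaining m^(3/2) is put in so
    that the mean of Z is summable over the scales. *)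
Lemma scale_discrepancy (m' : 'I_r.+1 -> nat) :
  let m w := (m' w).+1 in let mu := (\sum_w m' w)%N in
  let s0 := (\prod_w S w)%N in
  (2 ^ mu <= q)%N ->
  exists Z : tuple_F -> tuple_F -> R,
  [/\ forall alpha beta, 0 <= Z alpha beta,
      \sum_(beta : tuple_F | beta \in Primitive) \sum_(alpha : tuple_F) Z alpha beta <=
      (q ^ r.+1 * phi ^ r.+1)%N%:R *
        \prod_w ((193 * s ^ (2 * r.+1))%N%:R / ((m w)%:R * Num.sqrt (m w)%:R)) &
      forall alpha beta (N : {ffun 'I_r.+1 -> nat}),
      (forall w, (2 ^ m' w <= N w < 2 ^ m w)%N) ->
      discrepancy (fun n : {dffun forall w : 'I_r.+1, 'I_(N w)} =>
         @xvec R p k r.+1 s F chF alpha beta S (fun w => n w : nat)) <=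
      s0%:R * (2 / 2 ^+ mu) + (11 * mu.+1)%N%:R ^+ s0 *
        Num.sqrt ((\prod_w (2 ^ m w * m w ^ 5))%N%:R * Z alpha beta) / (\prod_w N w)%N%:R].
Proof.
move=> m mu s0 muq.
have [zeta zetaX zeta1] := unity_root_exists R (prime_gt1 p_pr).
pose D := (2 ^ (\sum_w m w))%N.
have m_D w : (2 ^ m w <= D)%N by rewrite leq_exp2l // (bigD1 w) //= leq_addr.
have m_gt0 w : (0 < m w)%N by [].
pose Box : finType := {dffun forall w : 'I_r.+1, 'I_(S w)}.
have [W [W0 sW hW]] := discrepancy_fourier p_pr zetaX zeta1 Box k_gt0 muq.
have cBox : #|Box| = s0 by exact: card_dffun_ord.
rewrite cBox in sW hW.
pose Wb : R := (11 * mu.+1)%N%:R ^+ s0; pose P : R := (\prod_w (2 ^ m w * m w ^ 5))%N%:R.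
have Wb0 : 0 < Wb by rewrite exprn_gt0 // ltr0n.
have P0 : 0 < P.
  by rewrite ltr0n; apply: prodn_gt0 => w; rewrite muln_gt0 !expn_gt0.
pose maj (H : {ffun Box -> {ffun 'I_k -> 'F_p}}) alpha beta : R :=
  net_majorant s chF zeta D D m H alpha beta.
have maj0 H alpha beta : 0 <= maj H alpha beta.
  rewrite mulr_ge0 // sumr_ge0 // => J _; rewrite sumr_ge0 // => a _.
  by rewrite exprn_ge0 ?normc_ge0.
pose V alpha beta := \sum_(H : {ffun Box -> {ffun 'I_k -> 'F_p}} | H != 0) W H * maj H alpha beta.
have V0 alpha beta : 0 <= V alpha beta by apply: sumr_ge0 => H _; rewrite mulr_ge0.
have sW' : \sum_(H : {ffun Box -> {ffun 'I_k -> 'F_p}} | H != 0) W H <= Wb.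
  apply: le_trans sW; rewrite [X in _ <= X](bigD1 (0 : {ffun Box -> {ffun 'I_k -> 'F_p}})) //=.
  by rewrite lerDr.
exists (fun alpha beta => V alpha beta / (Wb * P)); split.
- by move=> alpha beta; rewrite divr_ge0 // mulr_ge0 // ltW.
- rewrite (eq_bigr (fun beta : tuple_F => (\sum_(alpha : tuple_F) V alpha beta) / (Wb * P)));
    last by move=> beta _; rewrite mulr_suml.
  rewrite -mulr_suml ler_pdivrMr ?mulr_gt0 //.
  pose Mb := (q ^ r.+1 * \prod_w (m w ^ 2 * 2 ^ m w * (s ^ (2 * r.+1) * (phi + 2 * k * 2 ^ m w))))%N.
  have hV : \sum_(beta : tuple_F | beta \in Primitive) \sum_(alpha : tuple_F) V alpha beta
      <= Wb * Mb%:R.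
    rewrite /V; rewrite (eq_bigr (fun beta : tuple_F =>
      \sum_(H : {ffun Box -> {ffun 'I_k -> 'F_p}} | H != 0) \sum_(alpha : tuple_F) W H * maj H alpha beta)); last first.
      by move=> beta _; exact: exchange_big.
    rewrite exchange_big /=.
    apply: (@le_trans _ _ (\sum_(H : {ffun Box -> {ffun 'I_k -> 'F_p}} | H != 0) W H * Mb%:R)).
      apply: ler_sum => H H0.
      rewrite (eq_bigr (fun beta : tuple_F => W H * \sum_(alpha : tuple_F) maj H alpha beta));
        last by move=> beta _; rewrite mulr_sumr.
      rewrite -mulr_sumr ler_wpM2l //.
      exact: (majorant_moment chF p_pr k_gt0 s_gt0 S_le card_F zetaX zeta1 q_gt1 D m_D H0).
    by rewrite -mulr_suml ler_wpM2r.
  apply: (le_trans hV); rewrite mulrCA ler_pM2l // /Mb /P !natrM -!mulrA ler_wpM2l //.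
  rewrite !natr_prod natrX -[X in phi%:R ^+ X]card_ord -prodr_const mulrA -!big_split /=.
  apply: ler_prod => w _; rewrite ler0n /=.
  have mq : (2 ^ m w <= 2 * q)%N.
    rewrite expnS leq_mul2l /=; apply: leq_trans muq; rewrite leq_exp2l //.
    by rewrite /mu (bigD1 w) //= leq_addr.
  have := @totient_scale_real R p k (m w) (prime_gt1 p_pr) k_gt0 q_gt1 mq (m_gt0 w).
  set f := (phi + _)%N; set y := _ * Num.sqrt _ => hf.
  have m0 : (0 : R) < (m w)%:R by rewrite ltr0n.
  have y0 : 0 < y by rewrite mulr_gt0 ?sqrtr_gt0.
  have y2 : y ^+ 2 = (m w)%:R ^+ 3 by rewrite exprMn sqr_sqrtr ?ltW // -exprSr.
  rewrite !natrM !natrX.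
  apply: (@le_trans _ _ ((m w)%:R ^+ 2 * 2 ^+ m w * (s%:R ^+ (2 * r.+1) * (193 * phi%:R * y)))).
    by rewrite !ler_wpM2l ?mulr_ge0 ?exprn_ge0.
  set x := (m w)%:R; rewrite [X in _ <= _ * (_ * X)](_ : _ = x ^+ 2 * y ^+ 2); last by rewrite y2; ring.
  by rewrite le_eqVlt; apply/orP; left; apply/eqP; field; rewrite gt_eqF.
move=> alpha beta N hN.
have N0 w : (0 < N w)%N by have /andP[h _] := hN w; apply: leq_trans h; rewrite expn_gt0.
have ND w : (N w <= D)%N by have /andP[_ h] := hN w; apply: leq_trans (ltnW h) (m_D w).
pose T : finType := {dffun forall w : 'I_r.+1, 'I_(N w)}.
have cT : #|T| = (\prod_w N w)%N by exact: card_dffun_ord.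
have T0 : (0 < #|T|)%N by rewrite cT; apply: prodn_gt0.
pose z (t : T) (i : Box) := trace_digit k s chF alpha beta (fun v => t v + i v)%N.
have -> : (fun n : {dffun forall w : 'I_r.+1, 'I_(N w)} =>
    @xvec R p k r.+1 s F chF alpha beta S (fun w => n w : nat)) =
    (fun t i => digit_value R k (z t i)).
  by apply/funext => n; rewrite xvec_digit_value.
apply: (le_trans (hW T z T0)); rewrite lerD2l cT ler_pM2r ?invr_gt0 ?ltr0n -?cT //.
set E := \sum_(H | _) _.
have E0 : 0 <= E by apply: sumr_ge0 => H _; rewrite mulr_ge0 ?normc_ge0.
(* Cauchy-Schwarz with the weights W, then the maximal inequality for each H; V no longer depends on
   N. *)
have E2 : E ^+ 2 <= Wb * V alpha beta.
  apply: (le_trans (sqr_sum_weighted _ _ W0)).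
  apply: ler_pM => //; [exact: sumr_ge0 | by apply: sumr_ge0 => H _; rewrite mulr_ge0 ?sqr_ge0 |].
  apply: ler_sum => H _; rewrite ler_wpM2l //.
  have <- : \sum_(n : {ffun 'I_r.+1 -> 'I_D} | n \in family (fun w => [pred x : 'I_D | (x < N w)%N]))
     net_psi s chF zeta H alpha beta (fun w => n w) = \sum_t multi_psi zeta H (z t).
    by rewrite -(sum_dffun_box (fun n => net_psi s chF zeta H alpha beta n) N0 ND).
  by apply: rademacher_menshov => // w; have /andP[] := hN w.
rewrite -/P -/Wb.
have Q0 : 0 <= P * (V alpha beta / (Wb * P)) by rewrite mulr_ge0 ?divr_ge0 ?mulr_ge0 // ltW.
rewrite -(@ler_pXn2r _ 2) ?nnegrE ?mulr_ge0 ?sqrtr_ge0 ?(ltW Wb0) //.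
rewrite exprMn sqr_sqrtr // (le_trans E2) // le_eqVlt; apply/orP; left; apply/eqP.
by field; rewrite !gt_eqF.
Qed.

End ScaleDiscrepancy.

(** * Numerical estimates *)

Lemma ln_lower_bound (R : realType) (x : R) : 0 < x -> 1 - x^-1 <= ln x.
Proof.
move=> x0; have x1 : -1 < x^-1 - 1 by have := x0; rewrite -invr_gt0; lra.
have := le_ln1Dx x1; rewrite addrC subrK lnV ?posrE //; lra.
Qed.

(** By 1 - 1/x <= ln x one has ln 6 = ln (3/2) + 2 ln 2 >= 1/3 + 1, so the outer logarithm is at
    least ln 4 >= 1. *)
Lemma loglog_factor_ge1 (R : realType) (x a : R) : 1 <= x -> 0 <= a ->
  1 <= ln (3 * ln (6 * x)) `^ a.
Proof.
move=> x1 a0.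
have l2 : (2^-1 : R) <= ln 2 by have := @ln_lower_bound R 2 (ltr0Sn _ _); lra.
have l6 : (4 / 3 : R) <= ln (6 * x).
  have l32 : (1 / 3 : R) <= ln (3 / 2).
    apply: le_trans (@ln_lower_bound R (3 / 2) ltac:(lra)).
    by rewrite (_ : 1 - _ = 1 / 3); [exact: lexx | field].
  apply: (@le_trans _ _ (ln (3 / 2 * (2 * 2)))); last by rewrite ler_ln ?posrE; lra.
  rewrite [ln (3 / 2 * _)]lnM ?posrE; try lra.
  by rewrite [ln (2 * 2)]lnM ?posrE; lra.
have l4 : 1 <= ln (3 * ln (6 * x)).
  apply: (@le_trans _ _ (ln (2 * 2))); first by rewrite lnM ?posrE; lra.
  by rewrite ler_ln ?posrE; lra.
by rewrite -[X in X <= _](powRr0 (ln (3 * ln (6 * x)))) ler_powR.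
Qed.

Lemma powR_half_multiple (R : realType) (L : R) (s0 r : nat) : 0 < L ->
  L `^ (s0%:R + 5 / 2 * r%:R) = L ^+ s0 * (L ^+ 2 * Num.sqrt L) ^+ r.
Proof.
move=> L0; have L0' : L != 0 by rewrite gt_eqF.
rewrite powRD ?L0' ?implybT // powR_mulrn ?ltW //; congr (_ * _).
rewrite powRrM powR_mulrn ?powR_ge0 //; congr (_ ^+ _).
have -> : (5 / 2 : R) = 2%:R + 2^-1 by field.
by rewrite powRD ?L0' ?implybT // powR_mulrn ?ltW // powR12_sqrt ?ltW.
Qed.

(** The first term is the truncation error. In the second, 22 comes from 11 (mu + 1) <= 22 L, where
    L is the logarithm in the bound, and 8 = sqrt 64 from 2^m m^5 <= 2 N (2 L)^5 in each
    coordinate. *)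
Definition net_constant (R : realType) (r s : nat) (K : R) : R :=
  2 * s%:R * 2 ^+ r + 22 ^+ s * 8 ^+ r * K.

Lemma scale_bound_numeric (R : realType) (r s s0 : nat) (m' N : 'I_r.+1 -> nat) (eps K Z : R) :
  (1 < r.+1)%N -> (s0 <= s)%N -> (forall w, (2 ^ m' w <= N w < 2 ^ (m' w).+1)%N) ->
  0 < eps < 1 -> 1 <= K -> 0 <= Z <= K / eps ->
  let mu := (\sum_w m' w)%N in
  let M : R := (\prod_w N w)%N%:R in
  (s0%:R * (2 / 2 ^+ mu) + (11 * mu.+1)%N%:R ^+ s0 *
    Num.sqrt ((\prod_w (2 ^ (m' w).+1 * (m' w).+1 ^ 5))%N%:R * Z) / M <=
  eps^-1 * net_constant r.+1 s K * M `^ (- (1 / 2))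
    * ln (2 ^+ r.+2 * M) `^ (s0%:R + 5 / 2 * r.+1%:R)
    * ln (3 * ln (6 * M)) `^ (5 / 2 * r.+1%:R) : Prop).
Proof.
move=> r1 s0s hN /andP[e0 e1] K1 /andP[Z0 ZK] mu M.
have muM : (2 ^ mu <= \prod_w N w)%N.
  rewrite /mu expn_sum; apply: leq_prod => w _; by have /andP[] := hN w.
have Mmu : (\prod_w N w <= 2 ^ r.+1 * 2 ^ mu)%N.
  rewrite /mu expn_sum -[X in (2 ^ X * _)%N]card_ord -prod_nat_const -big_split /=.
  by apply: leq_prod => w _; rewrite -expnS; have /andP[_ /ltnW] := hN w.
have M1 : 1 <= M by rewrite ler1n; apply: leq_trans muM; rewrite expn_gt0.
have M0 : 0 < M by lra.
have sM0 : 0 < Num.sqrt M by rewrite sqrtr_gt0.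
have sM1 : 1 <= Num.sqrt M by rewrite -[X in X <= _]sqrtr1 ler_wsqrtr.
have sMM : Num.sqrt M ^+ 2 = M by rewrite sqr_sqrtr // (ltW M0).
have l2 : (2^-1 : R) <= ln 2 by have := @ln_lower_bound R 2 (ltr0Sn _ _); lra.
set L := ln (2 ^+ r.+2 * M).
have Lmu : (r.+2 + mu)%N%:R / 2 <= L.
  apply: (@le_trans _ _ (ln (2 ^+ (r.+2 + mu)))).
    by rewrite lnXn // -[X in _ <= X]mulr_natl ler_wpM2l.
  have a0 : 0 < 2 ^+ (r.+2 + mu) :> R by rewrite exprn_gt0.
  have b0 : 0 < 2 ^+ r.+2 * M by rewrite pmulr_rgt0 // exprn_gt0.
  rewrite /L ler_ln // exprD ler_wpM2l ?exprn_ge0 //.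
  by rewrite -natrX ler_nat.
have r3 : (3 : R) <= r.+2%:R by rewrite ler_nat.
have L1 : 1 <= L.
  by apply: le_trans Lmu; rewrite natrD; have : (0 : R) <= mu%:R by []; lra.
have L0 : 0 < L by lra.
have muL : mu.+1%:R <= 2 * L.
  have : (mu.+1%:R : R) <= (r.+2 + mu)%N%:R by rewrite ler_nat addSn ltnS leq_addl.
  lra.
set h := L ^+ 2 * Num.sqrt L.
have h1 : 1 <= h by rewrite mulr_ege1 ?exprn_ege1 // -[X in X <= _]sqrtr1 ler_wsqrtr.
have h2 : h ^+ 2 = L ^+ 5 by rewrite exprMn sqr_sqrtr ?(ltW L0) ?(ltW M0) ?(ltW e0) // -exprM -exprSr.
rewrite powR_half_multiple // -/h powRN (_ : 1 / 2 = 2^-1 :> R); last by rewrite div1r.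
rewrite powR12_sqrt ?(ltW M0) //.
have LL := @loglog_factor_ge1 R M (5 / 2 * r.+1%:R) M1 ltac:(by rewrite mulr_ge0 ?divr_ge0).
apply: (@le_trans _ _ (eps^-1 * net_constant r.+1 s K * (Num.sqrt M)^-1 * (L ^+ s0 * h ^+ r.+1))); last first.
  rewrite ler_peMr // !mulr_ge0 ?invr_ge0 ?exprn_ge0 ?(ltW L0) ?(ltW M0) ?(ltW e0) //; try lra.
  by rewrite addr_ge0 ?mulr_ge0 ?exprn_ge0 //; lra.
have ieps1 : 1 <= eps^-1 by rewrite invf_ge1 // (ltW e1).
set A := (Num.sqrt M)^-1; have A0 : 0 < A by rewrite invr_gt0.
have Ls1 : 1 <= L ^+ s0 by rewrite exprn_ege1.
have hr1 : 1 <= h ^+ r.+1 by rewrite exprn_ege1.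
have first_term : s0%:R * (2 / 2 ^+ mu) <=
    eps^-1 * (2 * s%:R * 2 ^+ r.+1) * A * (L ^+ s0 * h ^+ r.+1).
  have p0 : (0 : R) < 2 ^+ mu by rewrite exprn_gt0.
  have i2 : (2 ^+ mu)^-1 <= 2 ^+ r.+1 * A.
    rewrite -(ler_pM2r p0) mulVf ?gt_eqF //.
    have : M <= 2 ^+ r.+1 * 2 ^+ mu by rewrite -!natrX -natrM ler_nat.
    move=> hM; rewrite mulrAC ler_pdivlMr // mul1r (le_trans _ hM) //.
    by rewrite -[X in _ <= X]sMM ler_eXnr.
  apply: (@le_trans _ _ (s%:R * (2 * (2 ^+ r.+1 * A)))).
    by rewrite ler_pM ?divr_ge0 ?exprn_ge0 ?ler_nat // ler_wpM2l.
  rewrite (_ : s%:R * _ = (2 * s%:R * 2 ^+ r.+1) * A); last by ring.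
  set x := 2 * s%:R * 2 ^+ r.+1.
  have x0 : 0 <= x * A by rewrite mulr_ge0 ?(ltW A0) // /x !mulr_ge0 ?exprn_ge0.
  rewrite -[X in _ <= X]mulrA [X in _ <= X](_ : _ = (x * A) * (eps^-1 * (L ^+ s0 * h ^+ r.+1))); last by ring.
  by rewrite ler_peMr // !mulr_ege1.
have second_term : (11 * mu.+1)%N%:R ^+ s0 *
    Num.sqrt ((\prod_w (2 ^ (m' w).+1 * (m' w).+1 ^ 5))%N%:R * Z) / M <=
    eps^-1 * (22 ^+ s * 8 ^+ r.+1 * K) * A * (L ^+ s0 * h ^+ r.+1).
  have h22 : (11 * mu.+1)%N%:R ^+ s0 <= 22 ^+ s * L ^+ s0.
    apply: (@le_trans _ _ ((22 * L) ^+ s0)).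
      by apply: lerXn2r; rewrite ?nnegrE ?mulr_ge0 ?(ltW L0) // natrM; lra.
    by rewrite exprMn ler_wpM2r ?exprn_ge0 ?(ltW L0) ?(ltW M0) ?(ltW e0) // ler_weXn2l //; lra.
  have hprod : (\prod_w (2 ^ (m' w).+1 * (m' w).+1 ^ 5))%N%:R <= M * (64 * L ^+ 5) ^+ r.+1.
    rewrite /M !natr_prod -[X in _ ^+ X]card_ord -prodr_const -big_split /=.
    apply: ler_prod => w _; rewrite ler0n /= natrM.
    have mw : (m' w).+1%:R <= 2 * L.
      apply: le_trans muL; rewrite ler_nat ltnS /mu (bigD1 w) //=; exact: leq_addr.
    have hNw : (2 ^ (m' w).+1)%N%:R <= 2 * (N w)%:R :> R.
      by rewrite -natrM ler_nat expnS leq_mul2l; have /andP[-> _] := hN w.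
    apply: (@le_trans _ _ (2 * (N w)%:R * (2 * L) ^+ 5)).
      by rewrite ler_pM // natrX; apply: lerXn2r; rewrite ?nnegrE ?mulr_ge0 ?(ltW L0).
    by rewrite exprMn le_eqVlt; apply/orP; left; apply/eqP; ring.
  (* Hence sqrt (K / eps) <= K / eps, which produces the factor 1 / eps of the statement. *)
  have KE1 : 1 <= K / eps by rewrite mulr_ege1.
  have hs : Num.sqrt ((\prod_w (2 ^ (m' w).+1 * (m' w).+1 ^ 5))%N%:R * Z) <=
      Num.sqrt M * (8 ^+ r.+1 * h ^+ r.+1) * (K / eps).
    set B := Num.sqrt M * _ * _.
    have B0 : 0 <= B by rewrite !mulr_ge0 ?exprn_ge0 ?sqrtr_ge0 ?(ltW L0) ?(ltW M0) ?(ltW e0) //; lra.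
    rewrite -[B]ger0_norm // -sqrtr_sqr ler_wsqrtr //.
    apply: (@le_trans _ _ (M * (64 * L ^+ 5) ^+ r.+1 * (K / eps))).
      by rewrite ler_pM.
    have -> : B ^+ 2 = M * (64 * L ^+ 5) ^+ r.+1 * (K / eps) ^+ 2.
      rewrite /B exprMn exprMn sMM -exprMn -h2 exprAC (_ : (8 * h) ^+ 2 = 64 * h ^+ 2) //; ring.
    have X0 : 0 <= M * (64 * L ^+ 5) ^+ r.+1.
      by rewrite mulr_ge0 ?(ltW M0) // exprn_ge0 // mulr_ge0 // exprn_ge0 // (ltW L0).
    by rewrite ler_wpM2l // ler_eXnr.
  apply: (@le_trans _ _ (22 ^+ s * L ^+ s0 * (Num.sqrt M * (8 ^+ r.+1 * h ^+ r.+1) * (K / eps)) / M)).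
    by rewrite ler_pM2r ?invr_gt0 // ler_pM ?sqrtr_ge0 ?exprn_ge0.
  rewrite /A -[in X in _ / X]sMM le_eqVlt; apply/orP; left; apply/eqP.
  by field; rewrite !gt_eqF.
rewrite /net_constant; apply: (le_trans (lerD first_term second_term)).
by rewrite le_eqVlt; apply/orP; left; apply/eqP; ring.
Qed.

(** * Markov's inequality and the choice of the good parameters *)

(** The level 2 K / eps leaves an exceptional proportion of at most eps / 2; the factor 2 is there
    for the strict inequality. *)
Lemma markov_count (R : realType) (T : finType) (P : pred T) (Z : T -> R) (K eps : R) :
  0 < K -> 0 < eps -> (forall x, 0 <= Z x) -> \sum_(x | P x) Z x <= #|P|%:R * K ->
  (0 < #|P|)%N ->
  (1 - eps) * #|P|%:R < #|[set x | P x & Z x <= 2 * K / eps]|%:R.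
Proof.
move=> K0 e0 Z0 hZ P0; pose A := [set x | P x & Z x <= 2 * K / eps].
pose Bd := [set x | P x & ~~ (Z x <= 2 * K / eps)].
have cP : #|P| = (#|A| + #|Bd|)%N.
  rewrite -!sum1_card (bigID (fun x => Z x <= 2 * K / eps)) /=.
  by congr (_ + _)%N; apply: eq_bigl => x; rewrite inE.
have hB : #|Bd|%:R * (2 * K / eps) <= #|P|%:R * K.
  apply: le_trans hZ; rewrite mulr_natl -sumr_const.
  apply: (@le_trans _ _ (\sum_(x in Bd) Z x)).
    by apply: ler_sum => x; rewrite inE -ltNge => /andP[_ /ltW].
  rewrite [X in _ <= X](bigID (fun x => Z x <= 2 * K / eps)) /= [X in _ + X](eq_bigl (fun x => x \in Bd)); last first.
    by move=> x; rewrite !inE.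
  by rewrite lerDr; apply: sumr_ge0.
have hB' : 2 * #|Bd|%:R <= eps * #|P|%:R.
  rewrite -(ler_pM2r K0); have := hB; rewrite mulrA ler_pdivrMr //; lra.
have P0' : (0 : R) < #|P|%:R by rewrite ltr0n.
have : 0 < eps * #|P|%:R by rewrite mulr_gt0.
rewrite -/A; have : #|P|%:R = #|A|%:R + #|Bd|%:R :> R by rewrite cP natrD.
lra.
Qed.

Theorem theorem2 (R : realType) (r s : nat) (hr : (2 <= r)%N) (hs : (1 <= s)%N) :
  exists c2 : {ffun 'I_r -> nat} -> R,
  forall (p k : nat) (F : finFieldType) (chF : p \in [pchar F]) (eps : R),
    prime p -> (2 <= k)%N -> #|F| = (p ^ k)%N -> 0 < eps < 1 ->
  exists G : {set {ffun 'I_r -> F} * {ffun 'I_r -> F}},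
  [/\ (1 - eps) * (((p ^ k) ^ r * totient (p ^ k - 1) ^ r)%N%:R) < #|G|%:R,
      forall alpha beta, (alpha, beta) \in G ->
        forall i, (p ^ k - 1)%N.-primitive_root (beta i) &
      forall alpha beta, (alpha, beta) \in G ->
      forall N S : {ffun 'I_r -> nat},
        (forall w, (1 <= N w <= p ^ k)%N) ->
        (\prod_(w < r) N w <= p ^ k)%N ->
        (forall w, (1 <= S w <= s)%N) ->
        (\prod_(w < r) S w <= s)%N ->
        let M : R := (\prod_(w < r) N w)%N%:R in
        let s0 : R := (\prod_(w < r) S w)%N%:R in
        discrepancy (fun n : {dffun forall w : 'I_r, 'I_(N w)} =>
            @xvec R p k r s F chF alpha beta S (fun w => n w : nat))
        <= eps^-1 * c2 S * M `^ (- (1 / 2))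
           * ln (2 ^+ r.+1 * M) `^ (s0 + 5 / 2 * r%:R)
           * ln (3 * ln (6 * M)) `^ (5 / 2 * r%:R)].
Proof.
case: r hr => [//|{}r] hr.
pose C0 : R := (193 * s ^ (2 * r.+1))%N%:R.
have C01 : 1 <= C0 by rewrite ler1n muln_gt0 expn_gt0 hs.
(* K bounds the mean of [Z2]: there are (s + 1)^(r + 1) shapes, and in each coordinate the sum over
   the scales is at most 3 [C0]. *)
pose K : R := (s.+1 ^ r.+1)%N%:R * (C0 * 3) ^+ r.+1.
have K1 : 1 <= K.
  apply: mulr_ege1; first by rewrite ler1n expn_gt0.
  by apply/exprn_ege1/mulr_ege1 => //; rewrite ler1n.
(* The factor 2 is that of the Markov level; for given r and s one constant serves all shapes. *)
exists (fun=> net_constant r.+1 s (2 * K)).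
move=> p k F chF eps p_pr k2 cF /andP[e0 e1].
set q := (p ^ k)%N in cF *; set phi := totient (q - 1).
have q1 : (1 < q)%N by rewrite -(expn0 p) ltn_exp2l ?prime_gt1 //; lia.
have k0 : (0 < k)%N by lia.
pose Lam := (trunc_log 2 q).+1.
(* Shapes and scales form one finite index, so that a single exceptional set serves all S and N. *)
pose idx := ({ffun 'I_r.+1 -> 'I_s.+1} * {ffun 'I_r.+1 -> 'I_Lam})%type.
pose shape (x : idx) : {ffun 'I_r.+1 -> nat} := [ffun w => x.1 w : nat].
have shape_le x w : (shape x w <= s)%N by rewrite ffunE -ltnS.
pose Prim := family (fun=> mem (primitive_set p k F)) : {pred {ffun 'I_r.+1 -> F}}.
have /boolp.choice[Z hZ] (x : idx) :
  exists Z : {ffun 'I_r.+1 -> F} -> {ffun 'I_r.+1 -> F} -> R,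
  [/\ forall alpha beta, 0 <= Z alpha beta,
      \sum_(beta | beta \in Prim) \sum_alpha Z alpha beta <=
      (q ^ r.+1 * phi ^ r.+1)%N%:R *
        \prod_w (C0 / ((x.2 w).+1%:R * Num.sqrt (x.2 w).+1%:R)) &
      (2 ^ (\sum_w x.2 w) <= q)%N ->
      forall alpha beta (N : {ffun 'I_r.+1 -> nat}),
      (forall w, (2 ^ x.2 w <= N w < 2 ^ (x.2 w).+1)%N) ->
      discrepancy (fun n : {dffun forall w : 'I_r.+1, 'I_(N w)} =>
         @xvec R p k r.+1 s F chF alpha beta (shape x) (fun w => n w : nat)) <=
      (\prod_w shape x w)%N%:R * (2 / 2 ^+ (\sum_w x.2 w)%N) +
        (11 * (\sum_w x.2 w).+1)%N%:R ^+ (\prod_w shape x w)%N *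
        Num.sqrt ((\prod_w (2 ^ (x.2 w).+1 * (x.2 w).+1 ^ 5))%N%:R * Z alpha beta)
          / (\prod_w N w)%N%:R].
  case: (leqP (2 ^ (\sum_w x.2 w)) q) => hq.
    have [Z [h1 h2 h3]] := scale_discrepancy chF p_pr k0 hs (shape_le x) cF R q1 hq.
    by exists Z.
  (* Scales whose total exceeds log2 q get Z = 0 and a vacuous claim; the index set thus remains a
     full product, over which the means factor. *)
  exists (fun _ _ => 0); split=> //.
  by rewrite big1 ?mulr_ge0 ?prodr_ge0 // => *; rewrite ?divr_ge0 ?mulr_ge0 ?sqrtr_ge0 // big1.
pose Z2 (ab : {ffun 'I_r.+1 -> F} * {ffun 'I_r.+1 -> F}) := \sum_x Z x ab.1 ab.2.
have Z20 ab : 0 <= Z2 ab by apply: sumr_ge0 => x _; have [h _ _] := hZ x; exact: h.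
pose Omega := [pred ab : {ffun 'I_r.+1 -> F} * {ffun 'I_r.+1 -> F} | ab.2 \in Prim].
have cPrim : #|Prim| = (phi ^ r.+1)%N.
  rewrite card_family foldrE big_map big_enum prod_nat_const card_ord.
  by rewrite card_primitive_set.
have cOmega : #|Omega| = (q ^ r.+1 * phi ^ r.+1)%N.
  rewrite -cPrim -cF -[X in (_ ^ X)%N]card_ord -card_ffun -cardX.
  by apply: eq_card => -[a b]; rewrite !inE.
have phi0 : (0 < phi)%N by rewrite totient_gt0; lia.
have sumZ : \sum_(ab | Omega ab) Z2 ab <= #|Omega|%:R * K.
  rewrite cOmega.
  have -> : \sum_(ab | Omega ab) Z2 ab =
      \sum_x \sum_(beta | beta \in Prim) \sum_alpha Z x alpha beta.
    rewrite exchange_big /=; apply: eq_bigr => x _.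
    rewrite exchange_big pair_big /=; apply: eq_big => [[a b]|[a b] _] //.
  apply: (@le_trans _ _ (\sum_(x : idx) (q ^ r.+1 * phi ^ r.+1)%N%:R *
        \prod_w (C0 / ((x.2 w).+1%:R * Num.sqrt (x.2 w).+1%:R)))).
    by apply: ler_sum => x _; have [_ h _] := hZ x.
  rewrite -mulr_sumr ler_wpM2l // /K.
  pose f (j : nat) : R := C0 / (j.+1%:R * Num.sqrt j.+1%:R).
  rewrite -(pair_big xpredT xpredT (fun (_ : {ffun 'I_r.+1 -> 'I_s.+1})
    (m : {ffun 'I_r.+1 -> 'I_Lam}) => \prod_w f (m w))) /=.
  rewrite sumr_const card_ffun !card_ord -[X in X <= _]mulr_natl ler_wpM2l //.
  rewrite -(bigA_distr_bigA (fun _ (j : 'I_Lam) => f j)) prodr_const card_ord.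
  have f0 : 0 <= \sum_(j < Lam) f j.
    by apply: sumr_ge0 => j _; rewrite divr_ge0 ?mulr_ge0 ?sqrtr_ge0.
  apply: lerXn2r; rewrite ?nnegrE ?mulr_ge0 //.
  by rewrite /f -mulr_sumr ler_wpM2l // sum_inv_sqrt_cube.
have Omega0 : (0 < #|Omega|)%N by rewrite cOmega muln_gt0 ![(0 < _ ^ r.+1)%N]expn_gt0 phi0 (ltnW q1).
exists [set ab | Omega ab & Z2 ab <= 2 * K / eps]; split.
- by rewrite -cOmega; apply: markov_count => //; lra.
- move=> alpha beta; rewrite inE => /andP[/familyP hb _] w.
  by have := hb w; rewrite inE.
move=> alpha beta; rewrite inE => /andP[_ hZ2] N S hN NM hS SM.
pose m' := [ffun w => inord (trunc_log 2 (N w)) : 'I_Lam].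
have N0 w : (0 < N w)%N by have /andP[] := hN w.
have m'E w : m' w = trunc_log 2 (N w) :> nat.
  by rewrite ffunE inordK // ltnS leq_trunc_log //; have /andP[] := hN w.
have mN w : (2 ^ m' w <= N w < 2 ^ (m' w).+1)%N.
  by rewrite m'E trunc_logP //= trunc_log_ltn.
pose S' := [ffun w => inord (S w) : 'I_s.+1].
have eS : shape (S', m') = S.
  by apply/ffunP => w; rewrite !ffunE inordK // ltnS; have /andP[] := hS w.
have [Zx0 _ hx] := hZ (S', m').
have muq : (2 ^ (\sum_w m' w) <= q)%N.
  rewrite expn_sum; apply: leq_trans NM; apply: leq_prod => w _.
  by have /andP[] := mN w.
have := hx muq alpha beta N mN; rewrite eS => hd; cbv zeta.
apply: (le_trans hd); apply: scale_bound_numeric => //.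
- by rewrite e0.
- lra.
rewrite Zx0 /=; apply: le_trans hZ2; rewrite /Z2 (bigD1 (S', m')) //= lerDl.
by apply: sumr_ge0 => x _; have [h _ _] := hZ x; exact: h.
Qed.
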